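(* Assume that $|\arg\max_{j\in J}u_j(x)|=1$ for every $x\in X^I$, and that for every $j\in J$ the pure worldview $\alpha(j)$ has a unique optimal action, $z^*(\alpha(j))=\{x_j\}$. Let $\widehat\lambda<1$ be the threshold defined in the context. If $\widehat\lambda<\lambda<1$ and $0<\delta<1$, then every stationary MPE that exists reaches an absorbing pure worldview in finite time from every initial state: for every $\alpha_0\in\Delta^n$ there are $T\ge0$ and $j\in J$ with $\alpha_t=\alpha(j)$ for every $t\ge T$. For every stationary randomized MPE that exists and every fixed initial state, the time at which an absorbing pure worldview is reached is finite almost surely.
   Context: $J=\{1,\ldots,n\}$ and $X$ are nonempty finite sets (pure worldviews and actions) with payoffs $u_j(x)\in\mathbb R$; $M(x)=\max_{j\in J}u_j(x)$. $\Delta^n=\{\alpha\in\mathbb R^n:\alpha^j\ge0,\ \sum_j\alpha^j=1\}$; $\alpha(j)$ is the vertex with weight one on $j$ (pure worldview). $U(\alpha,x)=\sum_j\alpha^ju_j(x)$, $z^*(\alpha)=\arg\max_{x\in X}U(\alpha,x)$, $X^I=\bigcup_{\alpha\in\Delta^n}z^*(\alpha)$. Threshold: write $h_j=u_j(x_j)$ and $J^\dagger=\{j\in J:u_j(x_j)=M(x_j)\}$ (nonempty). For $j\in J^\dagger$ and $y\in X\setminus\{x_j\}$ put $D_{jy}=h_j-u_j(y)>0$ and $R_{jy}=M(y)-u_j(y)\ge0$, and $$\widehat\lambda=\max\Big(\{0\}\cup\Big\{1-\frac{D_{jy}}{R_{jy}}:j\in J^\dagger,\ y\in X\setminus\{x_j\},\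 R_{jy}>0\Big\}\Big)<1.$$ Pure strategies: a stationary pure strategy is a pair of arbitrary maps $\phi:\Delta^n\to\Delta^n$, $z:\Delta^n\to X$ (no continuity or measurability assumed). With $\phi^k$ the $k$-fold iterate, $$C_{\phi,z}(\beta;\alpha)=\sum_{k=0}^\infty\delta^k\big[(1-\lambda)U(\phi^k(\beta),z(\phi^k(\beta)))+\lambda U(\alpha,z(\phi^k(\beta)))\big].$$ A stationary MPE is a pair $(\phi,z)$ such that for every $\alpha$: $z(\alpha)\in z^*(\alpha)$, and $C_{\phi,z}(\phi(\alpha);\alpha)\ge C_{\phi,z}(\beta;\alpha)$ for every $\beta\in\Delta^n$. The path from $\alpha_0$ is $\alpha_{t+1}=\phi(\alpha_t)$, $x_t=z(\alpha_t)$. A state $\alpha$ is absorbing if $\phi(\alpha)=\alpha$. Randomized strategies: a stationary randomized strategy is a Borel probability kernel $\alpha\mapsto\Pi_\alpha$ from $\Delta^n$ to $X\times\Delta^n$, with marginals $s_\alpha$ on $X$ and $\kappa_\alpha$ on $\Delta^n$. From a fixed $\alpha_0$, conditional on the history $(\alpha_0,x_0,\ldots,x_{t-1},\alpha_t)$, the pair $(x_t,\alpha_{t+1})$ has law $\Pi_{\alpha_t}$; $\mathbb E_\beta$ is expectation when $\alpha_0=\beta$. Put $$C_\Pi(\beta;\alpha)=\mathbb E_\beta\sum_{k=0}^\infty\delta^k\big[(1-\lambda)U(\alpha_k,x_k)+\lambda U(\alpha,x_k)\big],\qquad S(\alpha)=\int C_\Pi(\beta;\alpha)\,\kappa_\alpha(d\beta).$$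 $\Pi$ is a stationary randomized MPE if for every $\alpha$: $s_\alpha(z^*(\alpha))=1$ and $S(\alpha)\ge C_\Pi(\gamma;\alpha)$ for every $\gamma\in\Delta^n$. A state $\alpha$ is absorbing if $\kappa_\alpha(\{\alpha\})=1$. *)

(* Defs.v *)
From HB Require Import structures.
From mathcomp Require Import all_boot all_order all_algebra.
From mathcomp Require Import all_classical all_reals all_analysis.
Import Order.TTheory GRing.Theory Num.Theory.
Import numFieldNormedType.Exports.
Set Implicit Arguments.
Unset Strict Implicit.
Unset Printing Implicit Defensive.
Local Open Scope classical_set_scope.
Local Open Scope ring_scope.

(* The nonempty set J = {1, ..., n} of pure worldviews is 'I_n.+1, i.e. the   *)
(* number of pure worldviews is n.+1.                                         *)

Section simplex.
Context (R : realType) (n : nat).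

Definition simplex_set : set 'rV[R]_n.+1 :=
  [set a | (forall j, 0 <= a 0 j) /\ \sum_j a 0 j = 1].

Definition simplex := set_type simplex_set.

HB.instance Definition _ := Choice.on simplex.
HB.instance Definition _ := Topological.on simplex.

Lemma delta_simplex (j : 'I_n.+1) : (delta_mx 0 j : 'rV[R]_n.+1) \in simplex_set.
Proof.
apply/mem_set; split=> [k|]; first by rewrite mxE ler0n.
rewrite (bigD1 j)//= big1 ?addr0 ?mxE ?eqxx// => k kj.
by rewrite mxE (negbTE kj) andbF.
Qed.

Definition vertex (j : 'I_n.+1) : simplex := SigSub (delta_simplex j).

Definition weight (a : simplex) (j : 'I_n.+1) : R := (val a : 'rV[R]_n.+1) 0 j.

(* measurable types of the library are pointed; the choice is irrelevant *)
HB.instance Definition _ := isPointed.Build simplex (vertex ord0).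

(* Borel sigma-algebra, from the topology induced by R^(n+1) *)
HB.instance Definition _ := @isMeasurable.Build (sigma_display (@open simplex))
  simplex <<s open >> (@sigma_algebra0 _ setT open) (@sigma_algebraC _ open)
  (@sigma_algebra_bigcup _ setT open).

End simplex.

(* A finite set of actions, with the discrete sigma-algebra. The element x0   *)
(* witnesses nonemptiness and is otherwise only the point of the library's    *)
(* measurable types.                                                          *)
Definition actions (X : finType) (x0 : X) : Type := X.

Section actions.
Context (X : finType) (x0 : X).
HB.instance Definition _ := Finite.on (actions x0).
HB.instance Definition _ := isPointed.Build (actions x0) x0.
HB.instance Definition _ := @isMeasurable.Build default_measure_display
  (actions x0) discrete_measurable discrete_measurable0
  discrete_measurableC discrete_measurableU.
End actions.

Section static.
Context (R : realType) (n : nat) (X : finType) (u : 'I_n.+1 -> X -> R).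
Implicit Types (a : simplex R n) (x y : X) (j : 'I_n.+1).

(* the seed u ord0 x is itself one of the values maximised *)
Definition maxpay x : R := \big[Num.max/u ord0 x]_j u j x.

Definition argmax_world x : {set 'I_n.+1} :=
  [set j | [forall k, u k x <= u j x]]%SET.

Definition util a x : R := \sum_j weight a j * u j x.

Definition zstar a : {set X} := [set x | [forall y, util a y <= util a x]]%SET.

Definition XI : set X := [set x | exists a, x \in zstar a].

(* In what follows xs j is the optimal action of the pure worldview j. *)
Definition Jdagger (xs : 'I_n.+1 -> X) : {set 'I_n.+1} :=
  [set j | u j (xs j) == maxpay (xs j)]%SET.

Definition gapD (xs : 'I_n.+1 -> X) j y : R := u j (xs j) - u j y.

Definition gapR j y : R := maxpay y - u j y.

Definition lambda_hat (xs : 'I_n.+1 -> X) : R :=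
  \big[Num.max/0]_(j in Jdagger xs)
    \big[Num.max/0]_(y : X | (y != xs j) && (0 < gapR j y))
      (1 - gapD xs j y / gapR j y).

End static.

Section dynamic.
Context (R : realType) (n : nat) (X : finType) (x0 : X).
Local Notation Delta := (simplex R n).
Local Notation act := (actions x0).
Context (u : 'I_n.+1 -> X -> R) (lambda delta : R).

(* flow payoff in state b with action x, as seen from worldview a *)
Definition flow (b : Delta) (x : X) (a : Delta) : R :=
  (1 - lambda) * util u b x + lambda * util u a x.

Definition discounted (b : nat -> Delta) (x : nat -> X) (a : Delta) : R :=
  limn (series (fun k => delta ^+ k * flow (b k) (x k) a)).

Section pure.
Context (phi : Delta -> Delta) (z : Delta -> X).

Definition C_pure (b a : Delta) : R :=
  discounted (fun k => iter k phi b) (fun k => z (iter k phi b)) a.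

Definition pure_MPE : Prop := forall a : Delta,
  z a \in zstar u a /\ forall b : Delta, C_pure b a <= C_pure (phi a) a.

Definition pure_absorbing (a : Delta) : Prop := phi a = a.

End pure.

Section randomized.
Context (Pi : R.-pker Delta ~> (act * Delta)%type).

Definition marg_act (a : Delta) : set act -> \bar R :=
  pushforward (Pi a) fst.

Definition marg_state (a : Delta) : set Delta -> \bar R :=
  pushforward (Pi a) snd.

Section process.
Context (d : measure_display) (Omega : measurableType d).
Context (st : nat -> {mfun Omega >-> Delta}) (ac : nat -> {mfun Omega >-> act}).

(* sigma-algebra of the history (st 0, ac 0, ..., ac (t-1), st t) *)
Definition history (t : nat) : set (set Omega) :=
  <<s \bigcup_(i in [set i | (i <= t)%N])
        preimage_set_system setT (st i) measurable `|`
      \bigcup_(i in [set i | (i < t)%N])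
        preimage_set_system setT (ac i) measurable >>.

(* Under P the process starts from b and, conditional on the history up to t, *)
(* (ac t, st t.+1) has law Pi (st t); the second clause is the defining       *)
(* property of the conditional probability of {(ac t, st t.+1) \in B}. Such a  *)
(* process exists for every kernel Pi (Ionescu-Tulcea), and its joint law is   *)
(* determined by Pi and b.                                                     *)
Definition process_law (b : Delta) (P : probability Omega R) : Prop :=
  P (st 0%N @^-1` [set b]) = 1%E /\
  forall (t : nat) (H : set Omega) (B : set (act * Delta)),
    history t H -> measurable B ->
    P (H `&` [set w | B (ac t w, st t.+1 w)]) =
      (\int[P]_(w in H) Pi (st t w) B)%E.

(* P b is the law of the process started from b *)
Context (P : Delta -> probability Omega R).

Definition C_rand (b a : Delta) : \bar R :=
  'E_(P b)[fun w => discounted (fun k => st k w) (fun k => ac k w) a]%E.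

Definition S_rand (a : Delta) : \bar R :=
  (\int[marg_state a]_b C_rand b a)%E.

Definition rand_MPE : Prop := forall a : Delta,
  marg_act a [set x | x \in zstar u a] = 1%E /\
  forall g : Delta, (C_rand g a <= S_rand a)%E.

End process.

Definition rand_absorbing (a : Delta) : Prop := marg_state a [set a] = 1%E.

End randomized.

End dynamic.

(* +oo if a never meets A *)
Definition hitting_time (R : realType) (T : Type) (A : set T) (a : nat -> T) :
    \bar R :=
  ereal_inf [set (t%:R)%:E | t in [set t | A (a t)]].

(* Main.v *)
From HB Require Import structures.
Require Import Defs.
From mathcomp Require Import all_boot all_order all_algebra.
From mathcomp Require Import all_classical all_reals all_analysis.
From mathcomp Require Import measurable_realfun ring lra.
Import Order.TTheory GRing.Theory Num.Theory.
Import numFieldNormedType.Exports.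
Set Implicit Arguments.
Unset Strict Implicit.
Unset Printing Implicit Defensive.
Local Open Scope classical_set_scope.
Local Open Scope ring_scope.

(* Write U* a for the maximum of U(a, .) and S a for the optimal continuation
   value at a. Optimality of the next state gives
   U*(a_t) <= (1 - delta) S(a_t) <= U*(a_{t+1}) along every equilibrium path, so
   by compactness the path has a cluster point b with (1 - delta) S b = U* b.
   Such a b must be a vertex at which its own optimal action attains M: a small
   move of size e towards a worldview that likes the current action better gains
   (1 - lambda) * e * const in the first period, while the loss from the later
   disagreement between the two selves is a second difference of S, which is
   o(e) because S is convex and Lipschitz. Near such a vertex the optimal action
   is constant, so an optimal next state is the vertex itself; the bound
   lambda > lambda_hat makes it absorbing, since no other flow payoff reaches
   its own. *)

(** * The simplex *)

(** No regularity of strategies is available: [phi] and [z] are arbitrary maps, and in the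
    randomized case [b |-> P b] is not assumed measurable. Limits are therefore taken only in [U*]
    and [S], which are Lipschitz whatever the strategy: the continuation value from a fixed state is
    affine in the evaluating worldview, and [S] is the upper envelope of these functions, each
    touching it at its own state. The envelope is also what turns the disagreement between two
    selves into a second difference: at the midpoint [y] of [b] and [c], the values that [b] and [c]
    give to the continuation from [y] add up to [2 * S y], and [c] gives it at most [S c]. The path
    argument uses nothing else about strategies, so it is run once, from the record
    [equilibrium_value]. That record speaks of values rather than of next states, because a
    randomized next state is constrained only up to null sets. *)

Lemma sum_continuous (R : realType) (T : topologicalType) (I : finType)
    (f : I -> T -> R) :
  (forall i, continuous (f i)) -> continuous (fun t => \sum_i f i t).
Proof.
move=> cf; elim: (index_enum I) => [|i s ih] t.
  by under eq_fun do rewrite big_nil; exact: cvg_cst.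
under eq_fun do rewrite big_cons.
by apply: cvgD; [exact: cf|exact: ih].
Qed.

Section simplex_geometry.
Context (R : realType) (n : nat).
Local Notation Delta := (simplex R n).
Implicit Types (a b c : Delta) (j k : 'I_n.+1).

Lemma weight_ge0 a j : 0 <= weight a j.
Proof. by have [h _] := set_mem (valP a); exact: h. Qed.

Lemma sum_weight a : \sum_j weight a j = 1.
Proof. by have [_ h] := set_mem (valP a). Qed.

Lemma weight_vertex j k : weight (vertex R j) k = (k == j)%:R.
Proof. by rewrite /weight /= mxE eqxx. Qed.

Lemma weight_inj a b : weight a =1 weight b -> a = b.
Proof. by move=> ab; apply/val_inj/rowP => j; exact: ab. Qed.

(** The l1 distance. [simplex] is equipped here with a topology only, and payoffs are visibly
    Lipschitz for this sum. *)
Definition sdist a b : R := \sum_j `|weight a j - weight b j|.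

Lemma sdist_ge0 a b : 0 <= sdist a b.
Proof. exact: sumr_ge0. Qed.

Lemma sdistC a b : sdist a b = sdist b a.
Proof. by apply: eq_bigr => j _; rewrite distrC. Qed.

Lemma sdistxx a : sdist a a = 0.
Proof. by rewrite /sdist big1// => j _; rewrite subrr normr0. Qed.

Lemma mixs_subproof (e : R) a b : 0 <= e <= 1 ->
  \row_j ((1 - e) * weight a j + e * weight b j) \in @simplex_set R n.
Proof.
move=> /andP[e0 e1]; apply/mem_set; split.
  by move=> j; rewrite mxE addr_ge0// mulr_ge0 ?weight_ge0// subr_ge0.
under eq_bigr do rewrite mxE.
by rewrite big_split/= -!mulr_sumr !sum_weight !mulr1 subrK.
Qed.

(* the segment from [a] to [b]; junk value [a] when [e] is not in [0, 1] *)
Definition mixs (e : R) a b : Delta :=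
  insubd a (\row_j ((1 - e) * weight a j + e * weight b j)).

Lemma weight_mixs (e : R) a b j : 0 <= e <= 1 ->
  weight (mixs e a b) j = (1 - e) * weight a j + e * weight b j.
Proof.
by move=> /mixs_subproof h; rewrite /weight /mixs val_insubd h mxE.
Qed.

Lemma sdist_mixs (e : R) a b : 0 <= e <= 1 -> sdist (mixs e a b) a <= e * 2.
Proof.
move=> /[dup] e01 /andP[e0 _]; rewrite /sdist.
under eq_bigr => j _.
  rewrite weight_mixs// (_ : _ - _ = e * (weight b j - weight a j)); last by ring.
  rewrite normrM ger0_norm//; over.
rewrite -mulr_sumr ler_wpM2l// (_ : 2 = \sum_j (weight b j + weight a j)); last first.
  by rewrite big_split/= !sum_weight.
apply: ler_sum => j _; rewrite (le_trans (ler_normB _ _))//.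
by rewrite !ger0_norm// weight_ge0.
Qed.

Lemma weight_continuous j : continuous (fun a => weight a j).
Proof.
move=> a; apply: (@continuous_comp _ _ _ (fun a : Delta => val a)
  (fun v : 'rV[R]_n.+1 => v 0 j)).
  exact: initial_continuous.
exact: coord_continuous.
Qed.

Lemma sdist_continuous b : continuous (fun a => sdist a b).
Proof.
apply: sum_continuous => j a.
exact: cvg_norm (cvgB (@weight_continuous j a) (cvg_cst _)).
Qed.

Lemma simplex_compact : compact (@simplex_set R n).
Proof.
apply: (@subclosed_compact _ _
  [set v : 'rV[R]_n.+1 | forall i, `[(0 : R), (1 : R)]%classic (v ord0 i)]).
- rewrite (_ : @simplex_set R n =
    \bigcap_(j in [set: 'I_n.+1]) [set v | 0 <= v 0 j] `&` [set v | \sum_j v 0 j = 1]).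
    apply: closedI.
      apply: closed_bigI => j _.
      apply: (preimage_closed (f := fun v : 'rV[R]_n.+1 => v 0 j)
        (D := [set x | 0 <= x])).
        by move=> v _; exact: coord_continuous.
      exact: closed_ge.
    apply: (preimage_closed (f := fun v : 'rV[R]_n.+1 => \sum_j v 0 j)
      (D := [set x | x = 1])).
      by move=> v _; apply: sum_continuous => j w; exact: coord_continuous.
    exact: closed_eq.
  by apply/seteqP; split => v [h1 h2]; split => // j; [move=> _; exact: h1|exact: h1].
- apply: (@rV_compact _ _ (fun=> `[(0 : R), (1 : R)]%classic)) => _.
  exact: segment_compact.
move=> v [v0 v1] i /=; rewrite in_itv/= v0/= -v1 (bigD1 i)//= lerDl.
exact: sumr_ge0.
Qed.

Lemma simplex_cluster (a : nat -> Delta) :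
  exists b, forall (e : R) (N : nat), 0 < e ->
    exists2 t, (N <= t)%N & sdist (a t) b < e.
Proof.
have [|v [vS vc]] := @simplex_compact (fmap (fun t => val (a t) : 'rV[R]_n.+1) \oo) _.
  by exists 0%N => // t _; exact: set_mem (valP (a t)).
exists (SigSub (mem_set vS) : Delta) => e N e0.
have := vc [set w | exists2 t, (N <= t)%N & w = val (a t)]
  [set w : 'rV[R]_n.+1 | \sum_j `|w 0 j - v 0 j| < e].
case.
- by exists N => // t Nt; exists t.
- have : continuous (fun w : 'rV[R]_n.+1 => \sum_j `|w 0 j - v 0 j|).
    apply: sum_continuous => j w.
    exact: cvg_norm (cvgB (@coord_continuous _ _ _ 0 j w) (cvg_cst _)).
  move=> /(_ v [set x | x < e]); apply => /=.
  apply: (@open_nbhs_nbhs _ _ [set x | x < e]); split; first exact: open_lt.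
  by rewrite /= big1// => j _; rewrite subrr normr0.
- by move=> w [[t Nt ->]] /= h; exists t.
Qed.

End simplex_geometry.

(** * Static payoffs and the threshold *)

Section payoffs.
Context (R : realType) (n : nat) (X : finType) (u : 'I_n.+1 -> X -> R).
Local Notation Delta := (simplex R n).
Implicit Types (a b : Delta) (j k : 'I_n.+1) (x y : X).

Lemma util_vertex j x : util u (vertex R j) x = u j x.
Proof.
rewrite /util (bigD1 j)//= big1 ?addr0; first by rewrite weight_vertex eqxx mul1r.
by move=> k /negbTE kj; rewrite weight_vertex kj mul0r.
Qed.

Lemma util_mixs (e : R) a b x : 0 <= e <= 1 ->
  util u (mixs e a b) x = (1 - e) * util u a x + e * util u b x.
Proof.
move=> e01; rewrite /util !mulr_sumr -big_split; apply: eq_bigr => j _.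
by rewrite weight_mixs//=; ring.
Qed.

(** A crude bound suffices, so a sum stands in for the maximum; the leading 1 makes it positive,
    hence usable as a divisor. *)
Definition payoff_bound : R := 1 + \sum_j \sum_x `|u j x|.

Lemma payoff_bound_gt0 : 0 < payoff_bound.
Proof. by rewrite ltr_pwDl// !sumr_ge0// => j _; exact: sumr_ge0. Qed.

Lemma ler_payoff_bound j x : `|u j x| <= payoff_bound.
Proof.
rewrite /payoff_bound (bigD1 j)//= (bigD1 x)//=.
have h1 : 0 <= \sum_(y | y != x) `|u j y| by exact: sumr_ge0.
have h2 : 0 <= \sum_(k | k != j) \sum_y `|u k y|.
  by apply: sumr_ge0 => k _; exact: sumr_ge0.
lra.
Qed.

Lemma util_bound a x : `|util u a x| <= payoff_bound.
Proof.
rewrite (le_trans (ler_norm_sum _ _ _))//.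
have -> : payoff_bound = \sum_j weight a j * payoff_bound.
  by rewrite -mulr_suml sum_weight mul1r.
apply: ler_sum => j _; rewrite normrM ger0_norm ?weight_ge0//.
by rewrite ler_wpM2l ?weight_ge0// ler_payoff_bound.
Qed.

Lemma util_lipschitz a b x :
  `|util u a x - util u b x| <= payoff_bound * sdist a b.
Proof.
rewrite /util -sumrB (le_trans (ler_norm_sum _ _ _))// mulr_sumr.
apply: ler_sum => j _; rewrite -mulrBl normrM mulrC.
by rewrite ler_wpM2r// ler_payoff_bound.
Qed.

Lemma le_maxpay j x : u j x <= maxpay u x.
Proof. exact: le_bigmax. Qed.

Lemma util_le_maxpay a x : util u a x <= maxpay u x.
Proof.
rewrite -[leRHS]mul1r -(sum_weight a) mulr_suml.
by apply: ler_sum => j _; rewrite ler_wpM2l ?weight_ge0// le_maxpay.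
Qed.

Lemma maxpay_attained x : exists j, maxpay u x = u j x.
Proof.
rewrite /maxpay; elim/big_ind: _ => [|r1 r2 [j1 ->] [j2 ->]|j _]; last 2 first.
- by case: (leP (u j1 x) (u j2 x)) => _; [exists j2|exists j1].
- by exists j.
by exists ord0.
Qed.

(** The shortfalls [maxpay u x - u k x] are nonnegative with nonpositive weighted mean, so weight
    can only lie where the shortfall is zero, and uniqueness of the best worldview leaves [j]
    alone. *)
Lemma util_eq_maxpay a x j : #|argmax_world u x| = 1%N ->
  u j x = maxpay u x -> maxpay u x <= util u a x -> a = vertex R j.
Proof.
move=> /eqP/cards1P[i xi] jx ax.
have argE k : (u k x == maxpay u x) = (k == i).
  have -> : (k == i) = (k \in argmax_world u x) by rewrite xi inE.
  rewrite inE; apply/eqP/forallP => [kx l|h].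
    by rewrite kx le_maxpay.
  by apply/eqP; rewrite eq_le le_maxpay/=; have [l ->] := maxpay_attained x.
have ij : i = j by apply/esym/eqP; rewrite -argE jx.
have w0 k : k != j -> weight a k = 0.
  move=> kj; have kx : 0 < maxpay u x - u k x.
    by rewrite subr_gt0 lt_neqAle le_maxpay andbT argE ij.
  have h : \sum_k weight a k * (maxpay u x - u k x) <= 0.
    under eq_bigr do rewrite mulrBr.
    by rewrite sumrB -mulr_suml sum_weight mul1r subr_le0.
  rewrite (bigD1 k)//= in h.
  have h' : 0 <= \sum_(l | l != k) weight a l * (maxpay u x - u l x).
    by apply: sumr_ge0 => l _; rewrite mulr_ge0 ?weight_ge0// subr_ge0 le_maxpay.
  have := weight_ge0 a k; rewrite le_eqVlt => /predU1P[//|wk].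
  have := mulr_gt0 wk kx; lra.
apply: weight_inj => k; rewrite weight_vertex; have [->|/w0//] := eqVneq k j.
by rewrite -(sum_weight a) (bigD1 j)//= big1 ?addr0.
Qed.

Definition Ustar (x0 : X) a : R := util u a [arg max_(x > x0) util u a x]%O.

Variant Ustar_spec (x0 : X) a : R -> Prop :=
  UstarSpec x of x \in zstar u a & (forall y, util u a y <= util u a x) :
    Ustar_spec x0 a (util u a x).

Lemma UstarP x0 a : Ustar_spec x0 a (Ustar x0 a).
Proof.
rewrite /Ustar; case: arg_maxP => //= x _ h; constructor; last by move=> y; exact: h.
by rewrite inE; apply/forallP => y; exact: h.
Qed.

Lemma util_le_Ustar x0 a x : util u a x <= Ustar x0 a.
Proof. by case: UstarP. Qed.

Lemma util_zstar x0 a x : x \in zstar u a -> util u a x = Ustar x0 a.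
Proof.
rewrite inE => /forallP h; apply/eqP; rewrite eq_le util_le_Ustar/=.
by case: UstarP.
Qed.

Lemma zstar_Ustar x0 a x : Ustar x0 a <= util u a x -> x \in zstar u a.
Proof.
by move=> h; rewrite inE; apply/forallP => y; exact: le_trans (util_le_Ustar x0 a y) h.
Qed.

Lemma Ustar_lipschitz x0 a b : `|Ustar x0 a - Ustar x0 b| <= payoff_bound * sdist a b.
Proof.
wlog ab : a b / Ustar x0 b <= Ustar x0 a.
  by move=> h; have [/h//|/ltW/h] := leP (Ustar x0 b) (Ustar x0 a); rewrite distrC sdistC.
rewrite ger0_norm ?subr_ge0//; case: (UstarP x0 a) => x _ _.
rewrite (le_trans _ (util_lipschitz a b x))// (le_trans _ (ler_norm _))// lerB//.
exact: util_le_Ustar.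
Qed.

Lemma Ustar_le x0 a : Ustar x0 a <= payoff_bound.
Proof. by case: (UstarP x0 a) => x _ _; exact: le_trans (ler_norm _) (util_bound a x). Qed.

(** Upper hemicontinuity of the argmax, quantified by the gap to the best suboptimal action. *)
Lemma zstar_near (x0 : X) b : exists2 e : R, 0 < e &
  forall a, sdist a b < e -> zstar u a \subset zstar u b.
Proof.
(* The least loss from a suboptimal action at [b]; the seed 1 covers the case where every action is
   optimal. *)
pose m := \big[Num.min/1]_(y | y \notin zstar u b) (Ustar x0 b - util u b y).
have m0 : 0 < m.
  apply: lt_bigmin => [|y]; first exact: ltr01.
  by apply: contraR; rewrite subr_gt0 -leNgt; exact: zstar_Ustar.
have B0 := payoff_bound_gt0.
(* Within this radius the optimal value and the payoff of one action each move by less than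
   [m / 2]. *)
exists (m / (2 * payoff_bound)); first by rewrite divr_gt0// mulr_gt0.
move=> a; rewrite ltr_pdivlMr ?mulr_gt0// => ab.
apply/fintype.subsetP => y ya; apply/negPn/negP => yb.
have h : m <= Ustar x0 b - util u b y by exact: bigmin_le_cond.
have /ler_normlP[_ h1] := Ustar_lipschitz x0 b a; rewrite sdistC in h1.
have /ler_normlP[_ h2] := util_lipschitz a b y.
have := util_zstar x0 ya; lra.
Qed.

Lemma zstar_near1 (x0 : X) b x : zstar u b = [set x]%SET ->
  exists2 e : R, 0 < e & forall a, sdist a b < e -> zstar u a = [set x]%SET.
Proof.
move=> bx; have [e e0 h] := zstar_near x0 b; exists e => // a /h; rewrite bx subset1.
by case/orP => /eqP// a0; case: (UstarP x0 a) => y; rewrite a0 inE.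
Qed.

End payoffs.

(** * The threshold inequality at vertices in [Jdagger] *)

Section threshold.
Context (R : realType) (n : nat) (X : finType) (u : 'I_n.+1 -> X -> R).
Context (xs : 'I_n.+1 -> X) (lambda : R).
Context (hxs : forall j : 'I_n.+1, zstar u (vertex R j) = [set xs j]%SET).
Context (hlambda : lambda_hat u xs < lambda < 1).
Implicit Types (j : 'I_n.+1) (y : X).

Lemma lambda_gt0 : 0 < lambda.
Proof. by case/andP: hlambda => h _; apply: le_lt_trans h; exact: bigmax_ge_id. Qed.

Lemma lambda_lt1 : lambda < 1.
Proof. by case/andP: hlambda. Qed.

Lemma Jdagger_maxpay j : j \in Jdagger u xs -> u j (xs j) = maxpay u (xs j).
Proof. by rewrite inE => /eqP. Qed.

Lemma opt_vertex j y : u j y <= u j (xs j).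
Proof.
have : xs j \in zstar u (vertex R j) by rewrite hxs set11.
by rewrite inE => /forallP/(_ y); rewrite !util_vertex.
Qed.

Lemma opt_vertex_lt j y : y != xs j -> u j y < u j (xs j).
Proof.
move=> yx; rewrite ltNge; apply/negP => h.
suff : y \in zstar u (vertex R j) by rewrite hxs inE (negbTE yx).
by rewrite inE; apply/forallP => z; rewrite !util_vertex (le_trans (opt_vertex j z)).
Qed.

Lemma XI_opt j : XI u (xs j).
Proof. by exists (vertex R j); rewrite hxs set11. Qed.

(** Rearranged, this is [(1 - lambda) * gapR < gapD]. For a positive [gapR] it is [lambda] exceeding
    one of the terms of [lambda_hat]; otherwise [u j y] equals [maxpay u y] and strict optimality of
    [xs j] suffices. *)
Lemma Jdagger_flow_lt j y : j \in Jdagger u xs -> y != xs j ->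
  (1 - lambda) * maxpay u y + lambda * u j y < u j (xs j).
Proof.
move=> jJ yx; have D0 := opt_vertex_lt yx.
have l1 := lambda_lt1.
have [R0|R0] := ltP 0 (gapR u j y); last first.
  rewrite /gapR in R0; have := le_maxpay u j y => h.
  have -> : maxpay u y = u j y by lra.
  lra.
have : 1 - gapD u xs j y / gapR u j y <= lambda_hat u xs.
  rewrite /lambda_hat.
  apply: le_trans (le_bigmax_cond _ (fun j => \big[Num.max/0]_(y : X |
      (y != xs j) && (0 < gapR u j y)) (1 - gapD u xs j y / gapR u j y)) jJ).
  by apply: (le_bigmax_cond _ (fun y => 1 - gapD u xs j y / gapR u j y)); rewrite yx.
case/andP: hlambda => hl _ /le_lt_trans/(_ hl); rewrite ltrBlDr -ltrBlDl => h.
have : (1 - lambda) * gapR u j y < gapD u xs j y by rewrite -ltr_pdivlMr.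
by rewrite /gapR /gapD; lra.
Qed.

End threshold.

(** * Equilibrium values *)

(** Phrased with a predicate so that no sequence has to be chosen. It serves twice: for slopes of
    the value along a segment, and for [U*] along a path at scattered times. *)
Lemma unbounded_increase (R : archiRealFieldType) (P : R -> Prop) (h M r : R) :
  0 < h -> P r -> (forall r, P r -> exists2 r', r + h <= r' & P r') ->
  (forall r, P r -> r <= M) -> False.
Proof.
move=> h0 Pr Pinc PM.
have step (m : nat) : exists2 r', r + m%:R * h <= r' & P r'.
  elim: m => [|m [r' rr' /Pinc[r'' r'r'' Pr'']]].
    by exists r => //; rewrite mul0r addr0.
  by exists r'' => //; rewrite -natr1; lra.
have [r' rr' /PM r'M] := step (Num.bound `|(M - r) / h|).
have : (M - r) / h < (Num.bound `|(M - r) / h|)%:R.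
  exact: le_lt_trans (ler_norm _) (archi_boundP (normr_ge0 _)).
by rewrite ltr_pdivrMr//; lra.
Qed.

(* [C b g] is the value at worldview [g] of starting the process at [b], and
   [K b g] its mean over the next state chosen at [b], [s b] being the law of
   the action at [b]. *)
Record equilibrium_value (R : realType) (n : nat) (X : finType) (x0 : X)
    (u : 'I_n.+1 -> X -> R) (lambda delta : R)
    (C K : simplex R n -> simplex R n -> R) (s : simplex R n -> X -> R) :=
  EquilibriumValue {
    law_ge0 : forall b x, 0 <= s b x;
    law_sum1 : forall b, \sum_x s b x = 1;
    law_supp : forall b x, x \notin zstar u b -> s b x = 0;
    bellman : forall b g, C b g = (1 - lambda) * Ustar u x0 b +
      lambda * \sum_x s b x * util u g x + delta * K b g;
    next_value_le : forall b g, K b g <= K g g;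
    value_le : forall b g, C b g <= K g g;
    next_value_mid : forall b g1 g2 g,
      (forall j, weight g1 j + weight g2 j = 2 * weight g j) ->
      K b g1 + K b g2 = 2 * K b g;
    next_value_lipschitz : exists2 k, 0 <= k &
      forall b g1 g2, K b g1 - K b g2 <= k * sdist g1 g2;
    next_value_absorbing : forall b, (forall c, C c b = K b b -> c = b) ->
      forall g, K b g = C b g }.

(** * Absorption derived from the value record alone *)

Section equilibrium.
Context (R : realType) (n : nat) (X : finType) (x0 : X).
Context (u : 'I_n.+1 -> X -> R) (xs : 'I_n.+1 -> X) (lambda delta : R).
Context (hXI : forall x : X, XI u x -> #|argmax_world u x| = 1%N)
    (hxs : forall j : 'I_n.+1, zstar u (vertex R j) = [set xs j]%SET)
    (hlambda : lambda_hat u xs < lambda < 1)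
    (hdelta : 0 < delta < 1).
Local Notation Delta := (simplex R n).
Context (C K : Delta -> Delta -> R) (s : Delta -> X -> R).
Context (EV : equilibrium_value x0 u lambda delta C K s).
Implicit Types (a b c g : Delta) (j : 'I_n.+1) (x : X).

Let S a := K a a.
Let U := Ustar u x0.

Let l0 : 0 < lambda. Proof. exact: lambda_gt0 hlambda. Qed.
Let l1 : lambda < 1. Proof. exact: lambda_lt1 hlambda. Qed.
Let d0 : 0 < delta. Proof. by case/andP: hdelta. Qed.
Let d1 : delta < 1. Proof. by case/andP: hdelta. Qed.

Lemma law_mean_le b (f : X -> R) (r : R) :
  (forall x, x \in zstar u b -> f x <= r) -> \sum_x s b x * f x <= r.
Proof.
move=> fr; rewrite -[leRHS]mul1r -(law_sum1 EV b) mulr_suml; apply: ler_sum => x _.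
have [/fr|/(law_supp EV)->] := boolP (x \in zstar u b); last by rewrite !mul0r.
by move=> h; rewrite ler_wpM2l// (law_ge0 EV).
Qed.

Lemma law_mean_cst b (f : X -> R) (r : R) :
  (forall x, x \in zstar u b -> f x = r) -> \sum_x s b x * f x = r.
Proof.
move=> fr; rewrite -[RHS]mul1r -(law_sum1 EV b) mulr_suml; apply: eq_bigr => x _.
by have [/fr->//|/(law_supp EV)->] := boolP (x \in zstar u b); rewrite !mul0r.
Qed.

(** Otherwise all terms [s b x * (f x - r)] are nonpositive while their sum is nonnegative, so every
    weight vanishes, against total mass 1. *)
Lemma law_mean_attained b (f : X -> R) (r : R) : r <= \sum_x s b x * f x ->
  exists2 x, x \in zstar u b & r <= f x.
Proof.
move=> h; apply: contrapT => nex.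
have lt x : x \in zstar u b -> f x < r.
  by move=> xb; rewrite ltNge; apply/negP => ?; apply: nex; exists x.
have : 0 <= \sum_x s b x * (f x - r).
  by under eq_bigr do rewrite mulrBr; rewrite sumrB -mulr_suml (law_sum1 EV) mul1r subr_ge0.
have le0 x : s b x * (f x - r) <= 0.
  have [/lt xr|/(law_supp EV)->] := boolP (x \in zstar u b); last by rewrite mul0r.
  by rewrite mulr_ge0_le0 ?(law_ge0 EV)// subr_le0 ltW.
move=> ge0.
have eq0 x : s b x = 0.
  have : s b x * (f x - r) = 0.
    apply/eqP; rewrite eq_le le0 /=; apply: le_trans ge0 _.
    by rewrite (bigD1 x)//= gerDl; apply: sumr_le0.
  move/eqP; rewrite mulf_eq0 => /orP[/eqP//|/eqP fx].
  by have [/lt|/(law_supp EV)//] := boolP (x \in zstar u b); lra.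
by have := law_sum1 EV b; rewrite big1// => /esym/eqP; rewrite oner_eq0.
Qed.

(** Choosing [a] itself as next state is worth [U a + delta * S a] to the self at [a]. *)
Lemma Ustar_le_value a : U a <= (1 - delta) * S a.
Proof.
have := value_le EV a a; rewrite (bellman EV) (law_mean_cst (r := U a)).
  by rewrite -/(S a) -/(U a); lra.
by move=> x; exact: util_zstar.
Qed.

(** The hypothesis says that [b] is an optimal next state at [a]. In its Bellman equation, what
    follows [b] is worth at most [S a] to [a]. *)
Lemma step_value a b : C b a = S a ->
  (1 - delta) * S a <= (1 - lambda) * U b + lambda * \sum_x s b x * util u a x.
Proof.
rewrite (bellman EV) -/(U b) => ba.
have := ler_wpM2l (ltW d0) (next_value_le EV b a); rewrite -/(S a) => h.
by lra.
Qed.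

(** The action taken at [b] gives [a] at most [U a], hence at most [(1 - delta) * S a]; removing
    this share from [step_value] leaves a factor [1 - lambda] on both sides. *)
Lemma step_Ustar a b : C b a = S a -> (1 - delta) * S a <= U b.
Proof.
move=> /step_value h.
have h1 : \sum_x s b x * util u a x <= U a.
  by apply: law_mean_le => x _; exact: util_le_Ustar.
have h2 := Ustar_le_value a.
have : lambda * (\sum_x s b x * util u a x) <= lambda * ((1 - delta) * S a).
  by rewrite ler_wpM2l ?(ltW l0)// (le_trans h1).
move=> h3; have : (1 - lambda) * ((1 - delta) * S a) <= (1 - lambda) * U b by lra.
by rewrite ler_pM2l// subr_gt0.
Qed.

(** Some action optimal at [b] must give a flow of at least [u j (xs j)]. The threshold excludes
    every action but [xs j], and then [b] must earn the maximum of [xs j], which only the vertex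
    does. *)
Lemma step_vertex j b : j \in Jdagger u xs ->
  C b (vertex R j) = S (vertex R j) -> b = vertex R j.
Proof.
move=> jJ /step_value.
have := Ustar_le_value (vertex R j).
rewrite -[U (vertex _ _)](util_zstar x0 (x := xs j)) ?hxs ?inE// util_vertex.
move=> h1 h2; have {h1 h2} := le_trans h1 h2.
have -> : (1 - lambda) * U b + lambda * (\sum_x s b x * util u (vertex R j) x) =
    \sum_x s b x * ((1 - lambda) * util u b x + lambda * u j x).
  rewrite -[in LHS](law_mean_cst (f := util u b) (b := b) (r := U b)); last first.
    by move=> x; exact: util_zstar.
  rewrite !mulr_sumr -big_split; apply: eq_bigr => x _ /=.
  by rewrite util_vertex; ring.
move=> /law_mean_attained[x xb hx].
have h : (1 - lambda) * util u b x <= (1 - lambda) * maxpay u x.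
  by rewrite ler_wpM2l ?util_le_maxpay// subr_ge0 ltW.
have [xE|xj] := eqVneq x (xs j); last first.
  by exfalso; have := Jdagger_flow_lt hxs hlambda jJ xj; lra.
subst x; apply: (util_eq_maxpay (hXI (XI_opt hxs j))); first exact: Jdagger_maxpay.
rewrite -(Jdagger_maxpay jJ).
have : (1 - lambda) * u j (xs j) <= (1 - lambda) * util u b (xs j) by lra.
by rewrite ler_pM2l// subr_gt0.
Qed.

(** By [step_vertex] the vertex is its own only optimal successor, so the Bellman equation closes on
    itself. *)
Lemma value_vertex j g : j \in Jdagger u xs ->
  (1 - delta) * C (vertex R j) g = (1 - lambda) * u j (xs j) + lambda * util u g (xs j).
Proof.
move=> jJ; have := bellman EV (vertex R j) g.
rewrite (next_value_absorbing EV) => [|c]; last exact: step_vertex.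
rewrite -[Ustar _ _ _](util_zstar x0 (x := xs j)) ?hxs ?inE// util_vertex.
rewrite (law_mean_cst (r := util u g (xs j))); first lra.
by move=> x; rewrite hxs inE => /eqP ->.
Qed.

(** Moving from [a] to the vertex instead would yield the same action [xs j] forever, so the
    [lambda] terms of the two options cancel. The condition bears on the next state [b], not on
    [a]. *)
Lemma step_near_vertex j a b : j \in Jdagger u xs ->
  zstar u b = [set xs j]%SET -> C b a = S a -> b = vertex R j.
Proof.
move=> jJ bj /step_value.
rewrite (law_mean_cst (r := util u a (xs j))); last by move=> x; rewrite bj inE => /eqP ->.
rewrite -[U b](util_zstar x0 (x := xs j)) ?bj ?inE// => h.
have : (1 - delta) * C (vertex R j) a <= (1 - delta) * S a.
  by rewrite ler_wpM2l ?(value_le EV)// subr_ge0 ltW.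
rewrite value_vertex// => h'.
apply: (util_eq_maxpay (hXI (XI_opt hxs j))); first exact: Jdagger_maxpay.
rewrite -(Jdagger_maxpay jJ).
have : (1 - lambda) * u j (xs j) <= (1 - lambda) * util u b (xs j) by lra.
by rewrite ler_pM2l// subr_gt0.
Qed.

(** [S] is an envelope of functions with a common Lipschitz constant: [S a - S b] is at most
    [K a a - K a b]. *)
Lemma value_lipschitz : exists2 k, 0 <= k & forall a b, `|S a - S b| <= k * sdist a b.
Proof.
have [k k0 h] := next_value_lipschitz EV; exists k => // a b.
wlog ab : a b / S b <= S a.
  by move=> h'; have [/h'//|/ltW/h'] := leP (S b) (S a); rewrite distrC sdistC.
rewrite ger0_norm ?subr_ge0// (le_trans _ (h a a b))// lerB//.
exact: next_value_le EV a b.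
Qed.

(* The vertices [j] with [u j x] above [util u b x] are excluded by comparing
   [b] with the points [y k] on the segment towards the vertex [j]: the slopes
   [r k] of the value along [y k] would decrease by [h] at each halving. *)
Lemma value_eq_Ustar b : (1 - delta) * S b = U b ->
  exists2 j, j \in Jdagger u xs & b = vertex R j.
Proof.
move=> SU.
have opt x j : x \in zstar u b -> u j x <= util u b x.
  move=> xb; rewrite leNgt; apply/negP => lt_bj.
  have [e e0 near_b] := zstar_near u x0 b.
  (* The bound 1 keeps [y k] on the segment; [e / 4] keeps it within [e / 2] of [b], where no new
     action becomes optimal. *)
  pose e1 : R := Num.min 1 (e / 4).
  have e10 : 0 < e1 by rewrite lt_min ltr01/= divr_gt0.
  have e11 : e1 <= 1 by rewrite ge_min lexx.
  have e14 : e1 <= e / 4 by rewrite ge_min lexx orbT.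
  pose ep k := e1 * 2^-1 ^+ k.
  have ep0 k : 0 < ep k by rewrite mulr_gt0// exprn_gt0.
  have ep1 k : ep k <= e1.
    by rewrite ler_piMr ?(ltW e10)// exprn_ile1//; lra.
  have epS k : ep k = 2 * ep k.+1 by rewrite /ep exprS; field.
  have ep01 k : 0 <= ep k <= 1 by rewrite (ltW (ep0 k))/= (le_trans (ep1 k)).
  pose y k := mixs (ep k) b (vertex R j).
  have yb k : sdist (y k) b <= 2 * ep k by rewrite mulrC sdist_mixs.
  have [L L0 SL] := value_lipschitz.
  (* The constant that [key] leaves after division by [delta] and by [2 * ep k.+1]. *)
  pose h := (1 - lambda) * (u j x - util u b x) / (2 * delta).
  have h0 : 0 < h by rewrite divr_gt0 ?mulr_gt0// subr_gt0.
  pose r k := (S (y k) - S b) / ep k.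
  have rS k : r k.+1 + h <= r k.
    have zy : zstar u (y k.+1) \subset zstar u b.
      by apply: near_b; have := yb k.+1; have := ep1 k.+1; lra.
    (* Actions optimal at [y k.+1] are optimal at [b] too, so the [lambda] term seen from [b] is
       exactly [U b]: the deviation costs nothing in the first period. *)
    have CE := bellman EV (y k.+1) b.
    rewrite (law_mean_cst (r := U b)) in CE; last first.
      by move=> z /(fintype.subsetP zy); exact: util_zstar.
    have Uy : U b + ep k.+1 * (u j x - util u b x) <= U (y k.+1).
      have := util_le_Ustar u x0 (y k.+1) x; rewrite -/(U _) util_mixs// util_vertex.
      by rewrite /U -(util_zstar x0 xb); lra.
    have Ky : K (y k.+1) b + K (y k.+1) (y k) = 2 * S (y k.+1).
      by apply: (next_value_mid EV) => i; rewrite !weight_mixs// (epS k); ring.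
    have Sy := next_value_le EV (y k.+1) (y k); rewrite -/(S _) in Sy.
    have Sb := value_le EV (y k.+1) b; rewrite -/(S _) in Sb.
    have hU := ler_wpM2l (ltW (_ : 0 < 1 - lambda)) Uy; rewrite subr_gt0 in hU.
    have hK : 0 <= delta * (S (y k) - K (y k.+1) (y k)).
      by rewrite mulr_ge0 ?(ltW d0)// subr_ge0.
    have {}hU := hU l1.
    have key : (1 - lambda) * (u j x - util u b x) * ep k.+1 <=
        delta * (S (y k) - 2 * S (y k.+1) + S b).
      rewrite -/(U _) in CE; rewrite -Ky; nra.
    have rE : r k - r k.+1 = (S (y k) - 2 * S (y k.+1) + S b) / (2 * ep k.+1).
      by rewrite /r (epS k); field; rewrite gt_eqF// mulr_gt0.
    rewrite -lerBrDl rE ler_pdivlMr ?mulr_gt0// /h.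
    rewrite mulrAC ler_pdivrMr ?mulr_gt0//; lra.
  apply: (@unbounded_increase R (fun z => exists k, z = - r k) h (2 * L) (- r 0%N)) => //.
  - by exists 0%N.
  - by move=> _ [k ->]; exists (- r k.+1); [have := rS k; lra|exists k.+1].
  move=> _ [k ->]; rewrite /r -mulNr ler_pdivrMr// opprB.
  have /ler_normlP[h1 _] := SL (y k) b; rewrite opprB in h1.
  by apply: le_trans h1 _; have := ler_wpM2l L0 (yb k); lra.
(* By [opt], [b] earns the maximum payoff of each of its optimal actions, which forces it to be a
   vertex. *)
have [x xb _] := UstarP u x0 b.
have [j jx] := maxpay_attained u x.
have bj : b = vertex R j.
  have xX : XI u x by exists b.
  apply: (util_eq_maxpay (hXI xX) (esym jx)).
  by rewrite jx; exact: opt.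
exists j => //; move: xb; rewrite bj hxs inE => /eqP xE.
by rewrite inE -xE jx.
Qed.

(** Stated for a bare sequence, with only the consequences of optimality that hold along it, so that
    it applies to one realised random path as well. *)
Lemma path_absorbed (a : nat -> Delta) :
  (forall t, (1 - delta) * S (a t) <= U (a t.+1)) ->
  (forall t j, j \in Jdagger u xs -> zstar u (a t.+1) = [set xs j]%SET ->
    a t.+1 = vertex R j) ->
  exists t j, j \in Jdagger u xs /\ a t = vertex R j.
Proof.
move=> aU aj; have [b ab] := simplex_cluster a.
have Umono t : U (a t) <= U (a t.+1) := le_trans (Ustar_le_value (a t)) (aU t).
have Umon t t' : (t <= t')%N -> U (a t) <= U (a t').
  by move=> tt'; apply: (@homo_leq _ (fun t => U (a t)) <=%O lexx le_trans).
have SU : (1 - delta) * S b = U b.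
  apply/eqP; rewrite eq_le Ustar_le_value andbT leNgt; apply/negP => lt_b.
  have [L L0 SL] := value_lipschitz.
  (* Half the gap: at a visit within [h / (L + B)] of [b] the errors in [S] and [U] together cost
     less than [h], so [U] still rises by [h] at the next step. *)
  pose h := ((1 - delta) * S b - U b) / 2.
  have h0 : 0 < h by rewrite divr_gt0// subr_gt0.
  pose B := payoff_bound u; have B0 : 0 < B := payoff_bound_gt0 u.
  apply: (@unbounded_increase R (fun z => exists t, z = U (a t)) h B (U (a 0%N))) => //.
  - by exists 0%N.
  - move=> _ [t ->]; have LB : 0 < L + B by rewrite ltr_wpDl.
    have [t' tt'] := ab (h / (L + B)) t (divr_gt0 h0 LB).
    rewrite ltr_pdivlMr// => t'b.
    exists (U (a t'.+1)); last by exists t'.+1.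
    apply: le_trans (aU t').
    have := Umon _ _ tt'.
    have /ler_normlP[_ h2] := Ustar_lipschitz u x0 (a t') b; rewrite -/(U _) in h2.
    have : (1 - delta) * (S b - S (a t')) <= L * sdist (a t') b.
      rewrite (le_trans _ (_ : `|S (a t') - S b| <= _))//.
      have e0 : 0 <= 1 - delta by rewrite subr_ge0 ltW.
      have := ler_wpM2l e0 (ler_norm (S b - S (a t'))); rewrite distrC.
      by have := mulr_ge0 (ltW d0) (normr_ge0 (S (a t') - S b)); lra.
    have hE : 2 * h = (1 - delta) * S b - U b by rewrite /h; field.
    by rewrite -/(U b) -/B in h2; lra.
  - by move=> _ [t ->]; exact: Ustar_le.
have [j jJ bj] := value_eq_Ustar SU.
have [e e0 near_b] := zstar_near1 x0 (hxs j).
(* The visit is taken at time at least 1, because the hypothesis on vertices concerns successors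
   only. *)
have [[//|t] _] := ab e 1%N e0.
rewrite bj => /near_b ta; exists t.+1, j; split => //; exact: aj.
Qed.

End equilibrium.

(** * Pure strategies *)

Section discounted_sum.
Context (R : realType) (delta : R) (hdelta : 0 < delta < 1).
Implicit Types (f g : nat -> R) (B c : R).

Let d0 : 0 < delta. Proof. by case/andP: hdelta. Qed.
Let d1 : delta < 1. Proof. by case/andP: hdelta. Qed.

Definition dterm f : nat -> R := fun k => delta ^+ k * f k.

Definition dsum f : R := limn (series (dterm f)).

Definition bounded_by B f := forall k, `|f k| <= B.

Lemma dsum_cvg B f : bounded_by B f -> cvgn (series (dterm f)).
Proof.
move=> fB; apply: normed_cvg.
apply: (@series_le_cvg _ _ (geometric B delta)) => /= [k|k|k|].
- exact: normr_ge0.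
- by rewrite mulr_ge0 ?exprn_ge0 ?(ltW d0)// (le_trans (normr_ge0 _) (fB k)).
- rewrite normrM ger0_norm ?exprn_ge0 ?(ltW d0)// mulrC.
  by rewrite ler_wpM2r ?exprn_ge0 ?(ltW d0)// fB.
- by apply: is_cvg_geometric_series; rewrite ger0_norm ?(ltW d0).
Qed.

Lemma dsum_cst c : dsum (fun=> c) = c / (1 - delta).
Proof.
apply/cvg_lim => //; have := @cvg_geometric_series R c delta.
rewrite ger0_norm ?(ltW d0)// => /(_ d1).
by rewrite (_ : geometric c delta = dterm (fun=> c))//; apply/funext => k; exact: mulrC.
Qed.

Lemma dsumD B1 B2 f g : bounded_by B1 f -> bounded_by B2 g ->
  dsum (fun k => f k + g k) = dsum f + dsum g.
Proof.
move=> fB gB; apply/cvg_lim => //.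
rewrite (_ : series _ = series (dterm f) \+ series (dterm g)).
  by apply: cvgD; [exact: dsum_cvg fB|exact: dsum_cvg gB].
apply/funext => m; rewrite /series/= -big_split/=.
by apply: eq_bigr => k _; rewrite /dterm mulrDr.
Qed.

Lemma dsum_le B1 B2 f g : bounded_by B1 f -> bounded_by B2 g ->
  (forall k, f k <= g k) -> dsum f <= dsum g.
Proof.
move=> fB gB fg; apply: ler_lim; [exact: dsum_cvg fB|exact: dsum_cvg gB|].
apply: nearW => m; apply: ler_sum => k _.
by rewrite ler_wpM2l// exprn_ge0 ?(ltW d0).
Qed.

Lemma dsum_recl B f : bounded_by B f ->
  dsum f = f 0%N + delta * dsum (fun k => f k.+1).
Proof.
move=> fB; have fSB : bounded_by B (fun k => f k.+1) by move=> k; exact: fB.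
apply/cvg_lim => //; rewrite -cvg_shiftS/=.
rewrite (_ : (fun m => series (dterm f) m.+1) =
    fun m => f 0%N + delta * series (dterm (fun k => f k.+1)) m).
  by apply: cvgD; [exact: cvg_cst|apply: cvgMr; exact: dsum_cvg fSB].
apply/funext => m; rewrite /series/= big_nat_recl//= /dterm expr0 mul1r; congr (_ + _).
by rewrite mulr_sumr; apply: eq_bigr => k _; rewrite exprS mulrA.
Qed.

Lemma dsum_bound B f : bounded_by B f -> `|dsum f| <= B / (1 - delta).
Proof.
move=> fB; have cB c : bounded_by `|c| (fun=> c) by move=> k.
rewrite ler_norml -mulNr -2!dsum_cst; apply/andP; split.
  by apply: (dsum_le (cB _) fB) => k; have := fB k; rewrite ler_norml => /andP[].
by apply: (dsum_le fB (cB _)) => k; have := fB k; rewrite ler_norml => /andP[].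
Qed.

Lemma dsum_sub_le B1 B2 c f g : bounded_by B1 f -> bounded_by B2 g ->
  (forall k, f k - g k <= c) -> dsum f - dsum g <= c / (1 - delta).
Proof.
move=> fB gB fg; have cB : bounded_by `|c| (fun=> c) by move=> k.
rewrite lerBlDl -dsum_cst -(dsumD gB cB); apply: (dsum_le fB (B2 := B2 + `|c|)).
  by move=> k; apply: le_trans (ler_normD _ _) (lerD (gB k) (cB k)).
by move=> k; rewrite -lerBlDl.
Qed.

End discounted_sum.

Section flow.
Context (R : realType) (n : nat) (X : finType).
Context (u : 'I_n.+1 -> X -> R) (lambda delta : R).
Context (hlambda : 0 <= lambda <= 1) (hdelta : 0 < delta < 1).
Local Notation Delta := (simplex R n).
Implicit Types (b : nat -> Delta) (x : nat -> X) (g a : Delta).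
Local Notation B := (payoff_bound u).

Lemma flow_bound c y g : `|flow u lambda c y g| <= B.
Proof.
case/andP: hlambda => l0 l1.
have l1' : 0 <= 1 - lambda by rewrite subr_ge0.
rewrite /flow (le_trans (ler_normD _ _))// !normrM.
rewrite (ger0_norm l0) (ger0_norm l1').
have := ler_wpM2l l1' (util_bound u c y).
have := ler_wpM2l l0 (util_bound u g y); lra.
Qed.

Lemma discountedE b x g :
  discounted u lambda delta b x g = dsum delta (fun k => flow u lambda (b k) (x k) g).
Proof. by []. Qed.

Lemma discounted_recl b x g : discounted u lambda delta b x g =
  flow u lambda (b 0%N) (x 0%N) g +
  delta * discounted u lambda delta (fun k => b k.+1) (fun k => x k.+1) g.
Proof. by rewrite discountedE (dsum_recl hdelta (B := B))// => k; exact: flow_bound. Qed.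

Lemma discounted_mid b x g1 g2 g :
  (forall j, weight g1 j + weight g2 j = 2 * weight g j) ->
  discounted u lambda delta b x g1 + discounted u lambda delta b x g2 =
  2 * discounted u lambda delta b x g.
Proof.
move=> hg; rewrite !discountedE mulr2n mulrDl mul1r.
rewrite -!(dsumD hdelta (B1 := B) (B2 := B)); try by move=> k; exact: flow_bound.
congr (dsum _ _); apply/funext => k; rewrite /flow.
have : util u g1 (x k) + util u g2 (x k) = 2 * util u g (x k).
  rewrite /util -big_split mulr_sumr; apply: eq_bigr => j _ /=.
  by rewrite -mulrDl hg mulrA.
by move=> h; rewrite addrACA -!mulrDr h; ring.
Qed.

(** The [1 - lambda] part of the flow does not involve the evaluating worldview and cancels. *)
Lemma discounted_lipschitz b x g1 g2 :
  discounted u lambda delta b x g1 - discounted u lambda delta b x g2 <=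
  B / (1 - delta) * sdist g1 g2.
Proof.
rewrite mulrAC; apply: dsum_sub_le => //; try by move=> k; exact: flow_bound.
move=> k; rewrite /flow opprD addrACA subrr add0r -mulrBr.
case/andP: hlambda => l0 l1.
have h : `|util u g1 (x k) - util u g2 (x k)| <= B * sdist g1 g2 by exact: util_lipschitz.
have := ler_wpM2l l0 (ler_norm (util u g1 (x k) - util u g2 (x k))).
have := ler_wpM2r (normr_ge0 (util u g1 (x k) - util u g2 (x k))) l1; lra.
Qed.

End flow.

Section pure.
Context (R : realType) (n : nat) (X : finType) (x0 : X).
Context (u : 'I_n.+1 -> X -> R) (lambda delta : R).
Context (hlambda : 0 <= lambda <= 1) (hdelta : 0 < delta < 1).
Local Notation Delta := (simplex R n).
Context (phi : Delta -> Delta) (z : Delta -> X).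
Context (mpe : pure_MPE u lambda delta phi z).

Let d0 : 0 < delta. Proof. by case/andP: hdelta. Qed.
Let d1 : delta < 1. Proof. by case/andP: hdelta. Qed.

Lemma pure_bellman b g : C_pure u lambda delta phi z b g =
  flow u lambda b (z b) g + delta * C_pure u lambda delta phi z (phi b) g.
Proof.
have it : (fun k => iter k phi (phi b)) = (fun k => iter k.+1 phi b).
  by apply/funext => k; rewrite iterSr.
rewrite [C_pure _ _ _ _ _ (phi b) _](congr1
  (fun p => discounted u lambda delta p (fun k => z (p k)) g) it).
exact: discounted_recl.
Qed.

(** The action law is the point mass at [z b]. One equilibrium inequality gives both value bounds,
    and the absorbing clause is its hypothesis applied to [phi b]. *)
Lemma pure_equilibrium_value : equilibrium_value x0 u lambda delta
  (C_pure u lambda delta phi z) (fun b => C_pure u lambda delta phi z (phi b))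
  (fun b x => (x == z b)%:R).
Proof.
split.
- by move=> b x; exact: ler0n.
- by move=> b; rewrite (bigD1 (z b))//= eqxx big1 ?addr0// => x /negbTE ->.
- by move=> b x; have [->|//] := eqVneq x (z b); rewrite (mpe b).1.
- move=> b g; rewrite pure_bellman /flow (util_zstar x0 (mpe b).1).
  congr (_ + _ * _ + _); rewrite (bigD1 (z b))//= eqxx mul1r big1 ?addr0//.
  by move=> x /negbTE ->; rewrite mul0r.
- by move=> b g; exact: (mpe g).2.
- by move=> b g; exact: (mpe g).2.
- by move=> b g1 g2 g hg; exact: discounted_mid.
- exists (payoff_bound u / (1 - delta)).
    by rewrite divr_ge0 ?(ltW (payoff_bound_gt0 u))// subr_ge0 ltW.
  by move=> b g1 g2; exact: discounted_lipschitz.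
- by move=> b /(_ (phi b) erefl) -> g.
Qed.

End pure.

Section pure_thm.
Context (R : realType) (n : nat) (X : finType) (x0 : X).
Context (u : 'I_n.+1 -> X -> R) (xs : 'I_n.+1 -> X) (lambda delta : R).
Context (hXI : forall x : X, XI u x -> #|argmax_world u x| = 1%N)
    (hxs : forall j : 'I_n.+1, zstar u (vertex R j) = [set xs j]%SET)
    (hlambda : lambda_hat u xs < lambda < 1)
    (hdelta : 0 < delta < 1).

Lemma lambda_unit : 0 <= lambda <= 1.
Proof. by rewrite (ltW (lambda_gt0 hlambda)) (ltW (lambda_lt1 hlambda)). Qed.

Lemma pure_absorption (phi : simplex R n -> simplex R n) (z : simplex R n -> X) :
  pure_MPE u lambda delta phi z ->
  forall a0 : simplex R n, exists (T : nat) (j : 'I_n.+1),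
    pure_absorbing phi (vertex R j) /\
    forall t : nat, (T <= t)%N -> iter t phi a0 = vertex R j.
Proof.
move=> mpe a0; have EV := pure_equilibrium_value x0 lambda_unit hdelta mpe.
have [||T [j [jJ Tj]]] := path_absorbed hXI hxs hlambda hdelta EV
    (a := fun t => iter t phi a0).
- by move=> t; exact: (step_Ustar hlambda hdelta EV).
- by move=> t j jJ tj; exact: (step_near_vertex hXI hxs hlambda hdelta EV jJ tj).
have absj : phi (vertex R j) = vertex R j.
  exact: (step_vertex hXI hxs hlambda hdelta EV jJ).
exists T, j; split => // t /subnK <-; rewrite iterD Tj.
by elim: (_ - _)%N => //= m ->.
Qed.

End pure_thm.

(** * Randomized strategies *)

Section simplex_measurability.
Context (R : realType) (n : nat).
Local Notation Delta := (simplex R n).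

Lemma continuous_simplex_measurable (f : Delta -> R) :
  continuous f -> measurable_fun [set: Delta] f.
Proof.
move=> /continuousP cf; apply: (measurability _ (RGenOpens.measurableE R)).
move=> _ [_ [a [b ->] <-]]; rewrite setTI.
by apply: sub_sigma_algebra; exact/cf/interval_open.
Qed.

Lemma lipschitz_continuous (f : Delta -> R) (k : R) : 0 <= k ->
  (forall a b, `|f a - f b| <= k * sdist a b) -> continuous f.
Proof.
move=> k0 fk a; apply/(@cvgrPdist_lt _ _ _ (nbhs a) (nbhs_filter a) f (f a)) => e e0.
(* [k + 1] is used since [k] may vanish. *)
have e1 : 0 < e / (k + 1) by rewrite divr_gt0// ltr_wpDl.
have : \forall c \near a, sdist c a < e / (k + 1).
  have := @sdist_continuous R n a a; move=> /(_ [set x | x < e / (k + 1)]); apply.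
  apply: (@open_nbhs_nbhs _ _ [set x | x < e / (k + 1)]); split; first exact: open_lt.
  by rewrite /= sdistxx.
apply: (@filterS _ _ (nbhs_filter a)) => c; rewrite ltr_pdivlMr ?ltr_wpDl// => ca.
apply: le_lt_trans (fk a c) _; rewrite sdistC.
by have := sdist_ge0 c a; lra.
Qed.

Lemma lipschitz_simplex_measurable (f : Delta -> R) (k : R) : 0 <= k ->
  (forall a b, `|f a - f b| <= k * sdist a b) -> measurable_fun [set: Delta] f.
Proof. by move=> k0 /(lipschitz_continuous k0)/continuous_simplex_measurable. Qed.

Lemma measurable_simplex1 (a : Delta) : measurable [set a].
Proof.
rewrite (_ : [set a] = (fun b => sdist b a) @^-1` [set 0]).
  rewrite -[X in measurable X]setTI.
  exact: (continuous_simplex_measurable (@sdist_continuous R n a)).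
apply/seteqP; split => [_ ->|b /= ba]; first by rewrite /= sdistxx.
apply: weight_inj => j; apply/eqP; rewrite -subr_eq0 -normr_le0 -ba.
by rewrite /sdist (bigD1 j)//= lerDl sumr_ge0.
Qed.

Context (X : finType) (x0 : X) (u : 'I_n.+1 -> X -> R).

Lemma measurable_util x : measurable_fun [set: Delta] (fun a => util u a x).
Proof.
apply: (lipschitz_simplex_measurable (ltW (payoff_bound_gt0 u))) => a b.
exact: util_lipschitz.
Qed.

Lemma measurable_Ustar : measurable_fun [set: Delta] (Ustar u x0).
Proof.
apply: (lipschitz_simplex_measurable (ltW (payoff_bound_gt0 u))) => a b.
exact: Ustar_lipschitz.
Qed.

Lemma measurable_zstar_in x : measurable [set a : Delta | x \in zstar u a].
Proof.
rewrite (_ : [set _ | _] = (fun a => Ustar u x0 a - util u a x) @^-1` [set 0]).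
  rewrite -[X in measurable X]setTI; apply: measurable_funB => //.
    exact: measurable_Ustar.
  exact: measurable_util.
apply/seteqP; split => a /= => [/(util_zstar x0) ->|/eqP]; first by rewrite subrr.
by rewrite subr_eq0 => /eqP aE; apply: (zstar_Ustar (x0 := x0)); rewrite aE.
Qed.

Lemma measurable_zstar_eq (A : {set X}) : measurable [set a : Delta | zstar u a = A].
Proof.
rewrite (_ : [set _ | _] = \bigcap_(x in [set: X])
    (if x \in A then [set a : Delta | x \in zstar u a]
     else ~` [set a : Delta | x \in zstar u a])).
  apply: fin_bigcap_measurable => // x _.
  by case: ifP => _; [|apply: measurableC]; exact: measurable_zstar_in.
apply/seteqP; split => a /= => [aA x _|h].
  by case: ifPn; rewrite -aA//= => /negP.
apply/setP => x; move: (h x I); case: (x \in A) => /= [->//|].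
by move/negP/negbTE.
Qed.

End simplex_measurability.

(** * Mixtures of kernels and means of bounded functions *)

Section mixture.
Context d1 d2 d3 (T : measurableType d1) (Y : measurableType d2)
  (Z : measurableType d3) (R : realType).
Context (mu : probability T R) (f : {mfun T >-> Y}) (k : R.-pker Y ~> Z).

(* [integral_kcomp] is stated for kernels on a product, hence the dummy [unit]. *)
Definition pullback_kernel (p : unit * T) : {measure set Z -> \bar R} := k (f p.2).

Let measurable_pullback_kernel B : measurable B ->
  measurable_fun setT (pullback_kernel ^~ B).
Proof.
move=> mB; apply: (measurableT_comp (measurable_kernel k B mB)).
exact: measurableT_comp.
Qed.

HB.instance Definition _ := isKernel.Build _ _ _ _ _ pullback_kernel
  measurable_pullback_kernel.

Let pullback_kernel_prob p : pullback_kernel p setT = 1%E.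
Proof. exact: prob_kernel. Qed.

HB.instance Definition _ := Kernel_isProbability.Build _ _ _ _ _ pullback_kernel
  pullback_kernel_prob.

(** [nu] is the composition of the constant kernel [mu] with the pulled-back kernel, so this is the
    iterated integral for composed kernels. *)
Lemma ge0_integral_mixture (nu : {measure set Z -> \bar R}) (g : Z -> \bar R) :
  (forall B, measurable B -> nu B = (\int[mu]_w k (f w) B)%E) ->
  (forall z, 0 <= g z)%E -> measurable_fun setT g ->
  (\int[nu]_z g z = \int[mu]_w \int[k (f w)]_z g z)%E.
Proof.
move=> nuE g0 mg.
pose l := kprobability (@measurable_cst _ _ unit _ setT (mu : pprobability T R)).
have := @integral_kcomp _ _ _ _ _ _ R l pullback_kernel tt g g0 mg.
move=> <-; apply: eq_measure_integral => B mB _; exact: nuE.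
Qed.

End mixture.

(** Everything integrated below is bounded; this class implies integrability for probability
    measures and keeps means real-valued. *)
Definition bounded_measurable d (T : measurableType d) (R : realType) (f : T -> R) :=
  measurable_fun [set: T] f /\ exists M, forall x, `|f x| <= M.

Lemma bounded_measurable_comp d1 d2 (T : measurableType d1) (Y : measurableType d2)
    (R : realType) (f : Y -> R) (g : T -> Y) :
  measurable_fun setT g -> bounded_measurable f -> bounded_measurable (f \o g).
Proof.
by move=> mg [mf [M fM]]; split; [exact: measurableT_comp|exists M => x; exact: fM].
Qed.

Lemma bounded_measurable_cst d (T : measurableType d) (R : realType) (c : R) :
  bounded_measurable (fun _ : T => c).
Proof. by split; [exact: measurable_cst|exists `|c|]. Qed.

Lemma bounded_measurableD d (T : measurableType d) (R : realType) (f g : T -> R) :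
  bounded_measurable f -> bounded_measurable g ->
  bounded_measurable (fun x => f x + g x).
Proof.
move=> [mf [M fM]] [mg [N gN]]; split; first exact: measurable_funD.
by exists (M + N) => x; apply: le_trans (ler_normD _ _) (lerD (fM x) (gN x)).
Qed.

Lemma bounded_measurableZ d (T : measurableType d) (R : realType) (c : R) (f : T -> R) :
  bounded_measurable f -> bounded_measurable (fun x => c * f x).
Proof.
move=> [mf [M fM]]; split; first exact: measurable_funM.
by exists (`|c| * M) => x; rewrite normrM ler_wpM2l.
Qed.

Lemma bounded_measurable_indic d (T : measurableType d) (R : realType) (A : set T) :
  measurable A -> bounded_measurable (\1_A : T -> R).
Proof.
move=> mA; split; first exact: measurable_indic.
by exists 1 => x; rewrite indicE ger0_norm// lern1 leq_b1.
Qed.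

Section mean.
Context d (T : measurableType d) (R : realType) (mu : {measure set T -> \bar R}).
Context (mu1 : mu setT = 1%E).
Implicit Types (f g : T -> R).

Definition mean f : R := Rintegral mu setT f.

Lemma bounded_integrable f : bounded_measurable f -> mu.-integrable setT (EFin \o f).
Proof.
move=> [mf [M fM]]; apply: measurable_bounded_integrable => //.
  by rewrite mu1 ltry.
exists M; split; first exact: num_real.
by move=> M' MM' x _ /=; exact: le_trans (fM x) (ltW MM').
Qed.

Lemma meanE f : bounded_measurable f -> (\int[mu]_x (f x)%:E)%E = (mean f)%:E.
Proof.
move=> bf; rewrite /mean /Rintegral fineK// integrable_fin_num//.
exact: bounded_integrable.
Qed.

Lemma mean_cst c : mean (fun=> c) = c.
Proof. by rewrite /mean Rintegral_cst// mu1/= mulr1. Qed.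

Lemma meanD f g : bounded_measurable f -> bounded_measurable g ->
  mean (fun x => f x + g x) = mean f + mean g.
Proof. by move=> bf bg; rewrite /mean RintegralD//; exact: bounded_integrable. Qed.

Lemma meanZ c f : bounded_measurable f -> mean (fun x => c * f x) = c * mean f.
Proof. by move=> bf; rewrite /mean RintegralZl//; exact: bounded_integrable. Qed.

Lemma mean_le f g : bounded_measurable f -> bounded_measurable g ->
  (forall x, f x <= g x) -> mean f <= mean g.
Proof. by move=> bf bg fg; apply: le_Rintegral => //; exact: bounded_integrable. Qed.

Lemma mean_norm_le f M : bounded_measurable f -> (forall x, `|f x| <= M) -> `|mean f| <= M.
Proof.
move=> bf fM; have bc c := @bounded_measurable_cst _ T R c.
rewrite ler_norml -{1}(mean_cst (- M)) -{2}(mean_cst M); apply/andP; split;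
  by apply: mean_le => // x; have := fM x; rewrite ler_norml => /andP[].
Qed.

Lemma mean_indic A : measurable A -> mean \1_A = fine (mu A).
Proof. by move=> mA; rewrite /mean /Rintegral integral_indic// setIT. Qed.

Lemma eq_mean_ae f g : bounded_measurable f -> bounded_measurable g ->
  {ae mu, forall x, f x = g x} -> mean f = mean g.
Proof.
move=> [mf _] [mg _] fg; rewrite /mean /Rintegral; congr fine.
apply: ae_eq_integral => //; [exact/measurable_EFinP|exact/measurable_EFinP|].
by apply: filterS fg => x -> _.
Qed.

(** [m - f] is nonnegative with zero integral. This is how equality of an average with its upper
    bound becomes almost sure optimality. *)
Lemma mean_max_ae f m : bounded_measurable f -> (forall x, f x <= m) ->
  mean f = m -> {ae mu, forall x, f x = m}.
Proof.
move=> bf fm mf; have bc := @bounded_measurable_cst _ T R m.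
have bg : bounded_measurable (fun x => m + (- 1) * f x).
  by apply: bounded_measurableD => //; exact: bounded_measurableZ.
have : (\int[mu]_x `|(m + (- 1) * f x)%:E| = 0)%E.
  under eq_integral => x _ do rewrite gee0_abs ?lee_fin ?mulN1r ?subr_ge0//.
  have := meanE bg; rewrite meanD// ?meanZ// ?mean_cst ?mf ?mulN1r ?subrr//.
    by move=> h; apply: etrans h; apply: eq_integral => x _; rewrite mulN1r.
  exact: bounded_measurableZ.
move/(@ae_eq_integral_abs _ _ _ mu setT measurableT).
case: bg => /measurable_EFinP mg _ /(_ mg).
by apply: filterS => x /(_ I)[]; lra.
Qed.

Context (delta : R) (hdelta : 0 < delta < 1).

Lemma bounded_measurable_dsum (M : R) (F : nat -> T -> R) :
  (forall k, measurable_fun setT (F k)) -> (forall k x, `|F k x| <= M) ->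
  bounded_measurable (fun x => dsum delta (fun k => F k x)).
Proof.
move=> mF FM; split; last first.
  by exists (M / (1 - delta)) => x; apply: dsum_bound => // k; exact: FM.
apply: (@measurable_fun_cvg _ _ _ _ (fun m x => series (dterm delta (F ^~ x)) m)).
  by move=> m; apply: measurable_sum => k; exact: measurable_funM.
by move=> x _; apply: (dsum_cvg hdelta (B := M)) => k; exact: FM.
Qed.

Lemma mean_dsum (M : R) (F : nat -> T -> R) :
  (forall k, measurable_fun setT (F k)) -> (forall k x, `|F k x| <= M) ->
  mean (fun x => dsum delta (fun k => F k x)) = dsum delta (fun k => mean (F k)).
Proof.
move=> mF FM; case/andP: hdelta => d0 d1.
have bF k : bounded_measurable (F k) by split=> //; exists M => x; exact: FM.
have mFM k : `|mean (F k)| <= M by apply: mean_norm_le.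
(* Quantified over [G] because splitting off the first term shifts the sequence; after [m]
   splittings only the tails can differ, at weight [delta ^+ m]. *)
have bound (m : nat) : forall G : nat -> T -> R, (forall k, measurable_fun setT (G k)) ->
    (forall k x, `|G k x| <= M) ->
    `|mean (fun x => dsum delta (fun k => G k x)) - dsum delta (fun k => mean (G k))|
      <= delta ^+ m * (2 * (M / (1 - delta))).
  elim: m => [|m ih] G mG GM.
    rewrite expr0 mul1r (le_trans (ler_normB _ _))// mulr_natl mulr2n lerD//.
      apply: mean_norm_le; first exact: bounded_measurable_dsum mG GM.
      by move=> x; apply: dsum_bound => // k; exact: GM.
    apply: dsum_bound => // k; apply: mean_norm_le => //.
    by split=> //; exists M => x; exact: GM.
  have bG k : bounded_measurable (G k) by split=> //; exists M => x; exact: GM.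
  have bGS : bounded_measurable (fun x => dsum delta (fun k => G k.+1 x)).
    by apply: bounded_measurable_dsum => // k x; exact: GM.
  rewrite (dsum_recl hdelta (B := M)); last by move=> k; apply: mean_norm_le.
  under [in mean _]eq_fun do rewrite (dsum_recl hdelta (B := M) (fun k => GM k _)).
  rewrite meanD// ?meanZ//; last exact: bounded_measurableZ.
  rewrite opprD addrACA subrr add0r -mulrBr normrM ger0_norm ?(ltW d0)// exprS -mulrA.
  by rewrite ler_wpM2l ?(ltW d0)// ih.
apply/eqP; rewrite -subr_eq0 -normr_le0 leNgt; apply/negP => gt0.
set e := `| _ - _| in gt0.
have M0 : 0 <= M / (1 - delta).
  rewrite divr_ge0 ?subr_ge0 ?(ltW d1)//.
  exact: le_trans (normr_ge0 _) (mFM 0%N).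
have : (fun m => delta ^+ m * (2 * (M / (1 - delta)))) @ \oo -->
    0 * (2 * (M / (1 - delta))).
  by apply: cvgMl; apply: cvg_expr; rewrite ger0_norm ?(ltW d0).
rewrite mul0r => /cvgrPdist_lt /(_ e gt0)[m _ /(_ m (leqnn m))] /=.
rewrite sub0r normrN ger0_norm; last first.
  by apply: mulr_ge0; [rewrite exprn_ge0 ?(ltW d0)|apply: mulr_ge0].
by rewrite ltNge (bound m F mF FM).
Qed.

End mean.

Lemma bounded_measurable_kernel d1 d2 (Y : measurableType d1) (Z : measurableType d2)
    (R : realType) (k : R.-pker Y ~> Z) (g : Z -> R) :
  bounded_measurable g -> bounded_measurable (fun a => mean (k a) g).
Proof.
move=> /[dup] bg [mg [M gM]].
have k1 a : k a setT = 1%E by exact: prob_kernel.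
split; last by exists M => a; exact: mean_norm_le.
(* Adding [M] makes the integrand nonnegative, as the kernel integral requires; the constant is
   subtracted afterwards. *)
have bgM : bounded_measurable (fun z => g z + M).
  by apply: bounded_measurableD => //; exact: bounded_measurable_cst.
have -> : (fun a => mean (k a) g) = (fun a => mean (k a) (fun z => g z + M) - M).
  apply/funext => a; rewrite meanD// ?mean_cst ?addrK//.
  exact: bounded_measurable_cst.
apply: measurable_funB => //; apply/measurable_EFinP.
rewrite (_ : EFin \o _ = fun a => \int[k a]_z (g z + M)%:E)%E; last first.
  by apply/funext => a; rewrite /= meanE.
apply: measurable_fun_integral_kernel => [U mU|z|].
- exact: measurable_kernel.
- by rewrite lee_fin; have := gM z; rewrite ler_norml => /andP[]; lra.
- by case: bgM => /measurable_EFinP.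
Qed.

Lemma ae_not d (T : measurableType d) (R : realType) (mu : {measure set T -> \bar R})
    (A : set T) : measurable A -> mu A = 0%E -> {ae mu, forall x, ~ A x}.
Proof. by move=> mA A0; exists A; split => // x /contrapT. Qed.

(** * The state process and its transition operator *)

Section process_means.
Context (R : realType) (n : nat) (X : finType) (x0 : X).
Local Notation Delta := (simplex R n).
Local Notation act := (actions x0).
Context (Pi : R.-pker Delta ~> (act * Delta)%type).
Context (d : measure_display) (Omega : measurableType d).
Context (st : nat -> {mfun Omega >-> Delta}) (ac : nat -> {mfun Omega >-> act}).
Context (b : Delta) (P : probability Omega R) (HP : process_law Pi st ac b P).

Let Pi1 a : Pi a setT = 1%E. Proof. exact: prob_kernel. Qed.
Let P1 : P setT = 1%E. Proof. exact: probability_setT. Qed.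

Let next t w := (ac t w, st t.+1 w).

Lemma measurable_next t : measurable_fun setT (next t).
Proof. exact: measurable_fun_pair. Qed.

Lemma measurable_state t A : measurable A -> measurable (st t @^-1` A).
Proof. by move=> mA; rewrite -[X in measurable X]setTI; exact: measurable_funPT. Qed.

Lemma process_law_event t A Q : measurable A -> measurable Q ->
  (P (st t @^-1` A `&` next t @^-1` Q) = \int[P]_(w in st t @^-1` A) Pi (st t w) Q)%E.
Proof.
move=> mA mQ; apply: HP.2 => //; apply: sub_sigma_algebra; left; exists t => //=.
by exists A => //; rewrite setTI.
Qed.

(** Every almost sure property of a step is obtained this way: the forbidden transitions form an
    event that the kernel does not charge from the states in [A]. *)
Lemma ae_next t A Q : measurable A -> measurable Q ->
  (forall a, A a -> Pi a Q = 0%E) ->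
  {ae P, forall w, ~ (A (st t w) /\ Q (ac t w, st t.+1 w))}.
Proof.
move=> mA mQ AQ; apply: (@ae_not _ _ _ _ (st t @^-1` A `&` next t @^-1` Q)).
  apply: measurableI; first exact: measurable_state.
  by rewrite -[X in measurable X]setTI; exact: measurable_next.
apply: (etrans (process_law_event t mA mQ)).
by apply: integral0_eq => w; exact: AQ.
Qed.

(** Passes from events, for which [process_law] is stated, to functions: the law of the pair is the
    mixture of [Pi] over the law of [st t]. *)
Lemma mean_next t (g : act * Delta -> R) : bounded_measurable g ->
  mean P (fun w => g (ac t w, st t.+1 w)) = mean P (fun w => mean (Pi (st t w)) g).
Proof.
move=> /[dup] bg [mg [M gM]].
have bc dY (Y : measurableType dY) := @bounded_measurable_cst dY Y R M.
have bgM : bounded_measurable (fun z => g z + M) by exact: bounded_measurableD.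
have gM0 z : (0 <= (g z + M)%:E)%E.
  by rewrite lee_fin; have := gM z; rewrite ler_norml => /andP[]; lra.
have mgM : measurable_fun setT (fun z => (g z + M)%:E).
  by case: bgM => /measurable_EFinP.
have := ge0_integral_pushforward (measurable_next t) P measurableT mgM (fun z _ => gM0 z).
rewrite (@ge0_integral_mixture _ _ _ _ _ _ _ P (st t) Pi
  (pushforward P (next t)))//; last first.
  move=> mn B mB; rewrite -[RHS](process_law_event t measurableT mB)//.
  by rewrite preimage_setT setTI.
  exact: measurable_next.
have bn : bounded_measurable (fun w => g (next t w)).
  exact: bounded_measurable_comp (measurable_next t) bg.
rewrite preimage_setT /= (meanE P1 (f := fun w => g (next t w) + M)); last first.
  exact: bounded_measurableD.
under eq_integral do rewrite meanE//.
have bk := bounded_measurable_comp (measurable_funPT (st t))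
  (bounded_measurable_kernel Pi bg).
rewrite (meanE P1 (f := fun w => mean (Pi (st t w)) (fun z => g z + M))); last first.
  exact: (bounded_measurable_comp (measurable_funPT (st t))
    (bounded_measurable_kernel Pi bgM)).
have -> : (fun w => mean (Pi (st t w)) (fun z => g z + M)) =
    (fun w => mean (Pi (st t w)) g + M).
  by apply/funext => w; rewrite meanD// mean_cst.
move=> [].
by rewrite !meanD// mean_cst// => /addIr ->.
Qed.

(** The Markov operator of the state component. *)
Definition next_mean (g : Delta -> R) (a : Delta) : R := mean (Pi a) (g \o snd).

Lemma bounded_measurable_next_mean g : bounded_measurable g ->
  bounded_measurable (next_mean g).
Proof.
by move=> bg; apply: bounded_measurable_kernel; exact: bounded_measurable_comp.
Qed.

Lemma mean_state t (g : Delta -> R) : bounded_measurable g ->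
  mean P (g \o st t) = iter t next_mean g b.
Proof.
elim: t g => [|t ih] g bg.
  rewrite /= -[RHS](mean_cst P1); apply: eq_mean_ae => //.
  - exact: bounded_measurable_comp.
  - exact: bounded_measurable_cst.
  have mb : measurable (st 0%N @^-1` [set b]).
    by apply: measurable_state; exact: measurable_simplex1.
  have : {ae P, forall w, ~ (~` (st 0%N @^-1` [set b])) w}.
    apply: (@ae_not _ _ _ _ (~` (st 0%N @^-1` [set b]))); first exact: measurableC.
    by apply: (etrans (probability_setC P mb)); rewrite HP.1 subee.
  by apply: filterS => w /contrapT /= ->.
rewrite iterSr -ih; last exact: bounded_measurable_next_mean.
rewrite (mean_next t (g := g \o snd))//.
exact: bounded_measurable_comp.
Qed.

End process_means.

Lemma mean_sum d (T : measurableType d) (R : realType) (mu : {measure set T -> \bar R})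
    (I : finType) (f : I -> T -> R) : mu setT = 1%E ->
  (forall i, bounded_measurable (f i)) ->
  mean mu (fun x => \sum_i f i x) = \sum_i mean mu (f i).
Proof.
move=> mu1 bf; suff h : forall s : seq I,
    bounded_measurable (fun x => \sum_(i <- s) f i x) /\
    mean mu (fun x => \sum_(i <- s) f i x) = \sum_(i <- s) mean mu (f i).
  exact: (h _).2.
elim=> [|i s [bs ih]].
  under eq_fun do rewrite big_nil.
  by rewrite big_nil mean_cst//; split=> //; exact: bounded_measurable_cst.
under eq_fun do rewrite big_cons.
by rewrite big_cons meanD// ih; split=> //; exact: bounded_measurableD.
Qed.

Lemma ae_imply d (T : measurableType d) (R : realType) (mu : {measure set T -> \bar R})
    (A B : T -> Prop) : (forall x, A x -> B x) ->
  {ae mu, forall x, A x} -> {ae mu, forall x, B x}.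
Proof. by move=> AB; exact: filterS. Qed.

Lemma measurable_actions (X : finType) (x0 : X) (A : set (actions x0)) : measurable A.
Proof. by []. Qed.

(** * Values of a randomized equilibrium *)

Section randomized.
Context (R : realType) (n : nat) (X : finType) (x0 : X).
Context (u : 'I_n.+1 -> X -> R) (lambda delta : R).
Context (hlambda : 0 <= lambda <= 1) (hdelta : 0 < delta < 1).
Local Notation Delta := (simplex R n).
Local Notation act := (actions x0).
Context (Pi : R.-pker Delta ~> (act * Delta)%type).
Context (d : measure_display) (Omega : measurableType d).
Context (st : nat -> {mfun Omega >-> Delta}) (ac : nat -> {mfun Omega >-> act}).
Context (P : Delta -> probability Omega R).
Context (HP : forall b, process_law Pi st ac b (P b)).
Context (mpe : rand_MPE u lambda delta Pi st ac P).
Implicit Types (a b c g : Delta) (x : X).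

Let Pi1 a : Pi a setT = 1%E. Proof. exact: prob_kernel. Qed.
Let P1 b : P b setT = 1%E. Proof. exact: probability_setT. Qed.
Let d0 : 0 < delta. Proof. by case/andP: hdelta. Qed.
Let d1 : delta < 1. Proof. by case/andP: hdelta. Qed.

Lemma bounded_measurable_action e (T : measurableType e) (f : T -> act) (v : X -> R) :
  measurable_fun setT f -> bounded_measurable (fun w => v (f w)).
Proof.
move=> mf; split.
  by apply: (measurableT_comp (f := v : act -> R)) => // _ B _; exact: measurable_actions.
exists (\sum_x `|v x|) => w; rewrite (bigD1 (f w : X))//= lerDl.
by apply: sumr_ge0.
Qed.

Definition path_payoff g w : R :=
  discounted u lambda delta (fun k => st k w) (fun k => ac k w) g.

Definition rand_value b g : R := mean (P b) (path_payoff g).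

Definition rand_mean_value b g : R := next_mean Pi (fun c => rand_value c g) b.

Definition action_law b x : R := mean (Pi b) (fun p => (p.1 == x)%:R).

Let flow_at g k w := flow u lambda (st k w) (ac k w) g.

Lemma measurable_flow g k : measurable_fun setT (flow_at g k).
Proof.
rewrite /flow_at /flow; apply: measurable_funD.
  apply: measurable_funM => //.
  rewrite (_ : (fun w => util u (st k w) (ac k w)) =
      fun w => \sum_(x : X) ((ac k w : X) == x)%:R * util u (st k w) x).
    apply: measurable_sum => x; apply: measurable_funM.
      exact: (@bounded_measurable_action _ _ (ac k) (fun y => (y == x)%:R) _).1.
    by apply: (measurableT_comp (measurable_util u x)).
  apply/funext => w; rewrite (bigD1 (ac k w : X))//= eqxx mul1r big1 ?addr0// => x.
  by rewrite eq_sym => /negbTE ->; rewrite mul0r.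
apply: measurable_funM => //.
exact: (@bounded_measurable_action _ _ (ac k) (util u g) _).1.
Qed.

Let flow_le g k w : `|flow_at g k w| <= payoff_bound u.
Proof. exact: flow_bound. Qed.

Lemma bounded_measurable_payoff g : bounded_measurable (path_payoff g).
Proof. exact: (bounded_measurable_dsum hdelta (measurable_flow g) (flow_le g)). Qed.

Lemma C_randE b g : C_rand u lambda delta st ac P b g = (rand_value b g)%:E.
Proof.
rewrite /C_rand unlock -(meanE (P1 b)) //.
exact: bounded_measurable_payoff.
Qed.

Lemma ae_action_opt b : {ae Pi b, forall p, p.1 \in zstar u b}.
Proof.
pose A : set (act * Delta) := fst @^-1` [set x : act | (x : X) \in zstar u b].
have mA : measurable A by rewrite -[A]setTI; exact: measurable_fst.
have := @mean_max_ae _ _ _ _ (Pi1 b) (\1_A) 1 (bounded_measurable_indic R mA).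
rewrite mean_indic// (_ : Pi b A = 1%E); last exact: (mpe b).1.
move=> /(_ _ erefl) h.
have {}h : {ae Pi b, forall p, (\1_A p : R) = 1}.
  by apply: h => p; rewrite indicE lern1 leq_b1.
apply: ae_imply h => p /eqP; rewrite indicE pnatr_eq1 eqb1.
by rewrite inE.
Qed.

Lemma bounded_measurable_action_eq b x : bounded_measurable
  (fun p : act * Delta => (p.1 == x)%:R : R).
Proof. exact: (@bounded_measurable_action _ _ fst (fun y => (y == x)%:R)). Qed.

Lemma action_law_supp b x : x \notin zstar u b -> action_law b x = 0.
Proof.
move=> xb; rewrite -[RHS](mean_cst (Pi1 b)); apply: eq_mean_ae => //.
- exact: bounded_measurable_action_eq.
- exact: bounded_measurable_cst.
apply: ae_imply (ae_action_opt b) => p pb.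
by case: eqVneq => // px; rewrite -px pb in xb.
Qed.

Lemma action_law_sum1 b : \sum_x action_law b x = 1.
Proof.
rewrite /action_law -(mean_sum (Pi1 b)); last first.
  by move=> x; exact: bounded_measurable_action_eq.
rewrite -[RHS](mean_cst (Pi1 b)); congr mean; apply/funext => p.
rewrite (bigD1 (p.1 : X))//= eqxx big1 ?addr0// => x.
by rewrite eq_sym => /negbTE ->.
Qed.

Lemma action_law_mean b (v : X -> R) :
  mean (Pi b) (fun p => v p.1) = \sum_x action_law b x * v x.
Proof.
transitivity (mean (Pi b) (fun p => \sum_(x : X) v x * ((p.1 : X) == x)%:R)).
  congr mean; apply/funext => p; rewrite (bigD1 (p.1 : X))//= eqxx mulr1 big1 ?addr0// => x.
  by rewrite eq_sym => /negbTE ->; rewrite mulr0.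
rewrite (mean_sum (Pi1 b)) => [|x]; last first.
  by apply: bounded_measurableZ; exact: bounded_measurable_action_eq.
apply: eq_bigr => x _; rewrite (meanZ (Pi1 b)); first exact: mulrC.
exact: bounded_measurable_action_eq.
Qed.

(** For each fixed action, choosing it where it is not optimal is a null transition; finitely many
    actions leave a null union. *)
Lemma ae_path_action_opt b k : {ae P b, forall w, (ac k w : X) \in zstar u (st k w)}.
Proof.
have h x : {ae P b, forall w, ~ (x \notin zstar u (st k w) /\ (ac k w : X) = x)}.
  pose A : set Delta := ~` [set a | x \in zstar u a].
  pose Q : set (act * Delta) := fst @^-1` [set x : act].
  have mA : measurable A by apply: measurableC; exact: measurable_zstar_in x0 _ _.
  have mQ : measurable Q by rewrite -[Q]setTI; exact: measurable_fst.
  have AQ a : A a -> Pi a Q = 0%E.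
    move=> /negP /action_law_supp.
    rewrite /action_law (_ : (fun _ => _) = \1_Q); last first.
      by apply/funext => p; rewrite indicE /Q/=; congr (nat_of_bool _)%:R; apply/idP/idP;
        rewrite inE => /eqP.
    rewrite mean_indic// => /eqP; rewrite fine_eq0; first by move/eqP.
    rewrite ge0_fin_numE//.
    have : (Pi a Q <= Pi a setT)%E by apply: le_measure; rewrite ?inE.
    by rewrite Pi1 => /le_lt_trans; apply; exact: ltry.
  apply: ae_imply (ae_next (HP b) k mA mQ AQ) => w nAQ [xw wx].
  by apply: nAQ; split => //; exact/negP.
have /(_ _) := filter_forall _ h.
apply: ae_imply => w hw; apply: contrapT => /negP hn.
exact: (hw (ac k w : X)).
Qed.

(** The mean flow given the current state; the own-payoff part is already [Ustar], since actions are
    almost surely optimal. *)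
Definition expected_flow g a : R :=
  (1 - lambda) * Ustar u x0 a + lambda * mean (Pi a) (fun p => util u g p.1).

Lemma bounded_measurable_util_action g :
  bounded_measurable (fun p : act * Delta => util u g p.1).
Proof. exact: (@bounded_measurable_action _ _ fst (util u g)). Qed.

Lemma bounded_measurable_Ustar : bounded_measurable (Ustar u x0 : Delta -> R).
Proof.
split; first exact: measurable_Ustar.
by exists (payoff_bound u) => a; case: UstarP => x _ _; exact: util_bound.
Qed.

Lemma bounded_measurable_expected_flow g : bounded_measurable (expected_flow g).
Proof.
apply: bounded_measurableD; apply: bounded_measurableZ.
  exact: bounded_measurable_Ustar.
exact: (bounded_measurable_kernel Pi (bounded_measurable_util_action g)).
Qed.

Lemma mean_flow b g k :
  mean (P b) (flow_at g k) = iter k (next_mean Pi) (expected_flow g) b.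
Proof.
have bflow : bounded_measurable (flow_at g k).
  by split; [exact: measurable_flow|exists (payoff_bound u)].
have bU : bounded_measurable (fun w => Ustar u x0 (st k w)).
  exact: bounded_measurable_comp (measurable_funPT (st k)) bounded_measurable_Ustar.
have bu : bounded_measurable (fun w => util u g (ac k w)).
  exact: (@bounded_measurable_action _ _ (ac k) (util u g)).
have bm : bounded_measurable (fun w => mean (Pi (st k w)) (fun p => util u g p.1)).
  exact: bounded_measurable_comp (measurable_funPT (st k))
    (bounded_measurable_kernel Pi (bounded_measurable_util_action g)).
rewrite -(mean_state (HP b)); last exact: bounded_measurable_expected_flow.
transitivity (mean (P b) (fun w => (1 - lambda) * Ustar u x0 (st k w) +
    lambda * util u g (ac k w))).
  apply: eq_mean_ae => //.
    by apply: bounded_measurableD; exact: bounded_measurableZ.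
  apply: ae_imply (ae_path_action_opt b k) => w /(util_zstar x0) wE.
  by rewrite /flow_at /flow wE.
rewrite (_ : _ \o _ = fun w => (1 - lambda) * Ustar u x0 (st k w) +
    lambda * mean (Pi (st k w)) (fun p => util u g p.1))//.
have bZ (r : R) (f : Omega -> R) : bounded_measurable f ->
    bounded_measurable (fun w => r * f w) by exact: bounded_measurableZ.
rewrite !(meanD (P1 b)) ?(meanZ (P1 b))//; try exact: bZ.
congr (_ + _ * _).
exact: (mean_next (HP b) k (bounded_measurable_util_action g)).
Qed.

Let iter_flow_le b g k : `|iter k (next_mean Pi) (expected_flow g) b| <= payoff_bound u.
Proof.
rewrite -mean_flow; apply: (mean_norm_le (P1 b)) => //.
by split; [exact: measurable_flow|exists (payoff_bound u)].
Qed.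

Let bounded_measurable_iter g k :
  bounded_measurable (iter k (next_mean Pi) (expected_flow g)).
Proof.
elim: k => [|k ih]; first exact: bounded_measurable_expected_flow.
exact: bounded_measurable_next_mean.
Qed.

(** The right-hand side depends on [Pi] alone. It yields measurability in [b], and the Bellman
    equation by splitting off the first term instead of restarting the process. *)
Lemma rand_valueE b g : rand_value b g =
  dsum delta (fun k => iter k (next_mean Pi) (expected_flow g) b).
Proof.
rewrite /rand_value /path_payoff.
rewrite (mean_dsum (P1 b) hdelta (measurable_flow g) (flow_le g)).
by congr (dsum _ _); apply/funext => k; rewrite mean_flow.
Qed.

Lemma bounded_measurable_rand_value g : bounded_measurable (fun b => rand_value b g).
Proof.
rewrite (_ : (fun b => _) = fun b =>
    dsum delta (fun k => iter k (next_mean Pi) (expected_flow g) b)); last first.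
  by apply/funext => b; rewrite rand_valueE.
apply: (bounded_measurable_dsum hdelta (M := payoff_bound u)) => [k|k b].
  exact: (bounded_measurable_iter g k).1.
exact: iter_flow_le.
Qed.

Let bounded_measurable_next_value g :
  bounded_measurable (fun p : act * Delta => rand_value p.2 g).
Proof. exact: bounded_measurable_comp measurable_snd (bounded_measurable_rand_value g). Qed.

Lemma rand_bellman b g : rand_value b g = (1 - lambda) * Ustar u x0 b +
  lambda * \sum_x action_law b x * util u g x + delta * rand_mean_value b g.
Proof.
rewrite rand_valueE (dsum_recl hdelta (iter_flow_le b g)) /= -action_law_mean.
congr (_ + _ * _); rewrite /rand_mean_value /next_mean.
rewrite (_ : _ \o _ = fun p => dsum delta (fun k =>
    (iter k (next_mean Pi) (expected_flow g) \o snd) p)); last first.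
  by apply/funext => p; rewrite /= rand_valueE.
rewrite (mean_dsum (Pi1 b) hdelta (M := payoff_bound u)) => //.
- move=> k; exact: (measurableT_comp (bounded_measurable_iter g k).1 measurable_snd).
- move=> k p; exact: iter_flow_le.
Qed.

Lemma S_randE a : S_rand u lambda delta Pi st ac P a = (rand_mean_value a a)%:E.
Proof.
rewrite /S_rand /marg_state.
under eq_integral do rewrite C_randE.
have bv := bounded_measurable_next_value a.
rewrite (integral_pushforward measurable_snd).
- exact: (meanE (Pi1 a) bv).
- by case: (bounded_measurable_rand_value a) => /measurable_EFinP.
- exact: (bounded_integrable (Pi1 a) bv).
- by [].
Qed.

Lemma rand_value_le b g : rand_value b g <= rand_mean_value g g.
Proof. by have := (mpe g).2 b; rewrite C_randE S_randE lee_fin. Qed.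

Lemma rand_value_mid b g1 g2 g :
  (forall j, weight g1 j + weight g2 j = 2 * weight g j) ->
  rand_value b g1 + rand_value b g2 = 2 * rand_value b g.
Proof.
move=> hg; rewrite /rand_value -(meanD (P1 b)) -?(meanZ (P1 b));
  try exact: bounded_measurable_payoff.
by congr mean; apply/funext => w; exact: discounted_mid.
Qed.

Lemma rand_value_lipschitz b g1 g2 :
  rand_value b g1 - rand_value b g2 <= payoff_bound u / (1 - delta) * sdist g1 g2.
Proof.
rewrite lerBlDl -[X in _ + X](mean_cst (P1 b)) -(meanD (P1 b)); last 2 first.
- exact: bounded_measurable_payoff.
- exact: bounded_measurable_cst.
apply: (mean_le (P1 b)) => [||w]; first exact: bounded_measurable_payoff.
  apply: bounded_measurableD; first exact: bounded_measurable_payoff.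
  exact: bounded_measurable_cst.
by rewrite -lerBlDl; exact: discounted_lipschitz.
Qed.

(** The equilibrium value is the average over next states of quantities that it bounds, so almost
    every next state is optimal. *)
Lemma ae_step b : {ae Pi b, forall p, rand_value p.2 b = rand_mean_value b b}.
Proof.
apply: (mean_max_ae (Pi1 b) (bounded_measurable_next_value b)) => // p.
exact: rand_value_le.
Qed.

Lemma rand_equilibrium_value : equilibrium_value x0 u lambda delta
  rand_value rand_mean_value action_law.
Proof.
have bv := bounded_measurable_next_value.
split.
- move=> b x; rewrite -(mean_cst (Pi1 b) 0); apply: (mean_le (Pi1 b)) => //.
    exact: bounded_measurable_cst.
  exact: bounded_measurable_action_eq.
- exact: action_law_sum1.
- exact: action_law_supp.
- exact: rand_bellman.
- move=> b g; rewrite -[leRHS](mean_cst (Pi1 b)); apply: (mean_le (Pi1 b)).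
  + exact: bv.
  + exact: bounded_measurable_cst.
  + by move=> p; exact: rand_value_le.
- exact: rand_value_le.
- move=> b g1 g2 g hg; rewrite /rand_mean_value /next_mean.
  rewrite -(meanD (Pi1 b)) -?(meanZ (Pi1 b)); try exact: bv.
  by apply: (congr1 (mean (Pi b))); apply/funext => p; exact: rand_value_mid.
- exists (payoff_bound u / (1 - delta)).
    by rewrite divr_ge0 ?(ltW (payoff_bound_gt0 u))// subr_ge0 ltW.
  move=> b g1 g2; rewrite lerBlDl -[X in _ + X](mean_cst (Pi1 b)) -(meanD (Pi1 b)).
    apply: (mean_le (Pi1 b)) => [||p]; first exact: bv.
      by apply: bounded_measurableD; [exact: bv|exact: bounded_measurable_cst].
    by rewrite -lerBlDl; exact: rand_value_lipschitz.
  + exact: bv.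
  + exact: bounded_measurable_cst.
- move=> b hb g; rewrite -[RHS](mean_cst (Pi1 b)); apply: eq_mean_ae.
  + exact: bv.
  + exact: bounded_measurable_cst.
  + by apply: ae_imply (ae_step b) => p /hb /= ->.
Qed.

End randomized.

(** * Almost sure absorption *)

Section rand_absorption.
Context (R : realType) (n : nat) (X : finType) (x0 : X).
Context (u : 'I_n.+1 -> X -> R) (xs : 'I_n.+1 -> X) (lambda delta : R).
Context (hXI : forall x : X, XI u x -> #|argmax_world u x| = 1%N)
    (hxs : forall j : 'I_n.+1, zstar u (vertex R j) = [set xs j]%SET)
    (hlambda : lambda_hat u xs < lambda < 1)
    (hdelta : 0 < delta < 1).
Local Notation Delta := (simplex R n).
Local Notation act := (actions x0).
Context (Pi : R.-pker Delta ~> (act * Delta)%type).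
Context (d : measure_display) (Omega : measurableType d).
Context (st : nat -> {mfun Omega >-> Delta}) (ac : nat -> {mfun Omega >-> act}).
Context (P : Delta -> probability Omega R).
Context (HP : forall b, process_law Pi st ac b (P b)).
Context (mpe : rand_MPE u lambda delta Pi st ac P).

Let Pi1 a : Pi a setT = 1%E. Proof. exact: prob_kernel. Qed.
Let l01 := lambda_unit hlambda.
Let C := rand_value u lambda delta st ac P.
Let K := rand_mean_value u lambda delta Pi st ac P.
Let EV : equilibrium_value x0 u lambda delta C K (action_law Pi) :=
  rand_equilibrium_value l01 hdelta HP mpe.
Let step a : {ae Pi a, forall p, C p.2 a = K a a} := ae_step l01 hdelta HP mpe a.

Lemma kernel_null (a : Delta) (Q : set (act * Delta)) : measurable Q ->
  (forall p, C p.2 a = K a a -> ~ Q p) -> Pi a Q = 0%E.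
Proof.
move=> mQ hQ; apply/eqP; rewrite -measure_le0.
have [N [mN N0 hN]] := step a.
rewrite -N0; apply: le_measure; rewrite ?inE// => p Qp.
by apply: hN => /hQ.
Qed.

Lemma vertex_rand_absorbing j : j \in Jdagger u xs ->
  rand_absorbing Pi (vertex R j).
Proof.
move=> jJ; have mj : measurable (snd @^-1` [set vertex R j] : set (act * Delta)).
  rewrite -[X in measurable X]setTI; apply: measurable_snd => //.
  exact: measurable_simplex1.
rewrite /rand_absorbing /marg_state /pushforward.
have h : Pi (vertex R j) (~` (snd @^-1` [set vertex R j])) = 0%E.
  apply: kernel_null; first exact: measurableC.
  by move=> p hp; apply; exact: (step_vertex hXI hxs hlambda hdelta EV jJ).
have := measureU (Pi (vertex R j)) mj (measurableC mj) (setICr _).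
by rewrite setUCr [X in (_ + X)%E]h adde0 => <-; exact: Pi1.
Qed.

(** [a] enters [K] twice, so measurability comes from the Lipschitz bound rather than from the
    kernel. *)
Lemma measurable_value : measurable_fun [set: Delta] (fun a => K a a).
Proof.
have [k k0 hk] := value_lipschitz EV.
exact: (lipschitz_simplex_measurable k0 hk).
Qed.

(* [process_law] only gives the probabilities of fixed events, so that the two
   sides are separated by rational levels. *)
Lemma ae_value_le_Ustar b t : {ae P b, forall w,
  (1 - delta) * K (st t w) (st t w) <= Ustar u x0 (st t.+1 w)}.
Proof.
pose A (r : rat) : set Delta := [set a | ratr r < (1 - delta) * K a a].
pose B (r : rat) : set Delta := [set a | Ustar u x0 a < ratr r].
have mA r : measurable (A r).
  rewrite (_ : A r = (fun a => (1 - delta) * K a a) @^-1` `]ratr r, +oo[); last first.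
    by apply/seteqP; split => a; rewrite /A/= in_itv/= andbT.
  rewrite -[X in measurable X]setTI.
  exact: (measurable_funM (measurable_cst _) measurable_value).
have mB r : measurable (snd @^-1` (B r) : set (act * Delta)).
  rewrite -[X in measurable X]setTI; apply: measurable_snd => //.
  rewrite (_ : B r = Ustar u x0 @^-1` `]-oo, ratr r[).
    by rewrite -[X in measurable X]setTI; exact: measurable_Ustar.
  by apply/seteqP; split => a; rewrite /B/= in_itv.
have h r : {ae P b, forall w, ~ (A r (st t w) /\ B r (st t.+1 w))}.
  apply: (ae_next (HP b) t (mA r) (mB r)) => a Aa.
  apply: kernel_null => // p /(step_Ustar hlambda hdelta EV) le_a Bp.
  by have := lt_trans (le_lt_trans le_a Bp) Aa; rewrite ltxx.
(* Rationals are enumerated by [unpickle], so that a countable intersection of almost sure events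
   applies. *)
have : {ae P b, forall w (m : nat), forall r, unpickle m = Some r ->
    ~ (A r (st t w) /\ B r (st t.+1 w))}.
  apply: ae_foralln => m; case: (unpickle m) => [r|]; last exact: aeW.
  by apply: ae_imply (h r) => w hw _ [<-].
apply: ae_imply => w hw; rewrite leNgt; apply/negP => /rat_in_itvoo[r].
rewrite in_itv/= => /andP[Br Ar].
exact: (hw (pickle r) r (pickleK r)).
Qed.

Lemma ae_near_vertex b t j : j \in Jdagger u xs -> {ae P b, forall w,
  zstar u (st t.+1 w) = [set xs j]%SET -> st t.+1 w = vertex R j}.
Proof.
move=> jJ; pose B : set Delta :=
  [set a | zstar u a = [set xs j]%SET] `&` ~` [set vertex R j].
have mB : measurable (snd @^-1` B : set (act * Delta)).
  rewrite -[X in measurable X]setTI; apply: measurable_snd => //.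
  apply: measurableI; first exact: measurable_zstar_eq x0 _ _.
  by apply: measurableC; exact: measurable_simplex1.
have h a : setT a -> Pi a (snd @^-1` B) = 0%E.
  move=> _; apply: kernel_null => // p hp [zp]; apply.
  exact: (step_near_vertex hXI hxs hlambda hdelta EV jJ zp hp).
apply: ae_imply (ae_next (HP b) t measurableT mB h) => w nB zw.
by apply: contrapT => nw; apply: nB; split.
Qed.

Lemma rand_absorption b : {ae P b, forall w : Omega,
  (hitting_time R
     [set a | (exists j, a = vertex R j) /\ rand_absorbing Pi a]
     (fun t => st t w) < +oo)%E}.
Proof.
have h1 : {ae P b, forall w t,
    (1 - delta) * K (st t w) (st t w) <= Ustar u x0 (st t.+1 w)}.
  by apply: ae_foralln => t; exact: ae_value_le_Ustar.
have h2 : {ae P b, forall w t j, j \in Jdagger u xs ->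
    zstar u (st t.+1 w) = [set xs j]%SET -> st t.+1 w = vertex R j}.
  apply: ae_foralln => t; apply: filter_forall => j.
  have [jJ|jJ] := boolP (j \in Jdagger u xs); last exact: aeW.
  by apply: ae_imply (ae_near_vertex b t jJ) => w hw _.
(* Countably many times and finitely many vertices leave one almost sure event, on which the
   deterministic path argument applies to each [w]. *)
apply: filterS2 h1 h2 => w h1 h2.
have [t [j [jJ tj]]] := path_absorbed hXI hxs hlambda hdelta EV h1 h2.
apply: le_lt_trans (ltry t%:R); apply: ereal_inf_lbound; exists t => //=.
by rewrite tj; split; [exists j|exact: vertex_rand_absorbing].
Qed.

End rand_absorption.

Theorem theorem6p6 (R : realType) (n : nat) (X : finType) (x0 : X)
    (u : 'I_n.+1 -> X -> R) (xs : 'I_n.+1 -> X) (lambda delta : R)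
    (hXI : forall x : X, XI u x -> #|argmax_world u x| = 1%N)
    (hxs : forall j : 'I_n.+1, zstar u (vertex R j) = [set xs j]%SET)
    (hlambda : lambda_hat u xs < lambda < 1)
    (hdelta : 0 < delta < 1) :
  (forall (phi : simplex R n -> simplex R n) (z : simplex R n -> X),
     pure_MPE u lambda delta phi z ->
     forall a0 : simplex R n, exists (T : nat) (j : 'I_n.+1),
       pure_absorbing phi (vertex R j) /\
       forall t : nat, (T <= t)%N -> iter t phi a0 = vertex R j) /\
  (forall (Pi : R.-pker (simplex R n) ~> (actions x0 * simplex R n)%type)
     (d : measure_display) (Omega : measurableType d)
     (st : nat -> {mfun Omega >-> simplex R n})
     (ac : nat -> {mfun Omega >-> actions x0})
     (P : simplex R n -> probability Omega R),
     (forall b : simplex R n, process_law Pi st ac b (P b)) ->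
     rand_MPE u lambda delta Pi st ac P ->
     forall a0 : simplex R n,
       {ae P a0, forall w : Omega,
          (hitting_time R
             [set a | (exists j, a = vertex R j) /\ rand_absorbing Pi a]
             (fun t => st t w) < +oo)%E}).
Proof.
split=> [phi z mpe a0|Pi d Omega st ac P HP mpe a0].
  exact: (pure_absorption x0 hXI hxs hlambda hdelta mpe).
exact: (rand_absorption hXI hxs hlambda hdelta HP mpe).
Qed.
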